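(* Let $F,G\in L^2(B,\mathcal B,\mu)$ and let $p,q>0$ be real numbers with $\frac1{p^2}+\frac1{q^2}=1$. If $\Gamma(p)F$ and $\Gamma(q)G$ are in $L^2(B,\mathcal B,\mu)$, then the Wick product $F\diamond G$ exists as an element of $L^2(B,\mathcal B,\mu)$.
   Context: $(B,H,\mu)$ is an abstract Wiener space: $H$ is a separable real Hilbert space, continuously and densely embedded in a Banach space $B$ with Borel $\sigma$-algebra $\mathcal B$, the dual $B'$ is identified with a dense subspace of $H$, and $\mu$ is a Borel measure on $B$ with $\int_B e^{i\langle l,x\rangle}d\mu(x)=e^{-\|l\|_H^2/2}$ for $l\in B'$. For $l\in H$, $\tilde l$ denotes the centered Gaussian random variable of variance $\|l\|_H^2$ obtained as the $L^2$-extension of $l\mapsto\langle l,\cdot\rangle$, $l\in B'$. $H^{\hat\otimes n}$ is the $n$-fold symmetric tensor product of $H$ (with the norm inherited from the full Hilbert tensor product). $H_n(x)=(-1)^ne^{x^2/2}\frac{d^n}{dx^n}e^{-x^2/2}$ is the $n$-th Hermite polynomial. The multiple integral $I_n:H^{\hat\otimes n}\to L^2(B,\mathcal B,\mu)$ is the continuous linear map with $I_n(h^{\otimes n})=\|h\|_H^nH_n(\tilde h/\|h\|_H)$ for $0\ne h\in H$ ($I_0$ is the identity on constants); it satisfies $\mathbb E|I_n(f_n)|^2=n!\|f_n\|^2_{H^{\hat\otimes n}}$. Every $F\in L^2(B,\mathcal B,\mu)$ has a unique chaos expansion $F=\sum_{n\ge0}I_n(f_n)$, $f_n\in H^{\hat\otimes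 n}$. Second quantization operator: $\Gamma(\alpha)F=\sum_{n\ge0}\alpha^nI_n(f_n)$ for $\alpha\in\mathbb R$; ''$\Gamma(\alpha)F\in L^2$'' means $\sum_n n!\,\alpha^{2n}\|f_n\|^2_{H^{\hat\otimes n}}<\infty$. Wick product: for finite sums, $\big(\sum_{n\le N_1}I_n(f_n)\big)\diamond\big(\sum_{m\le N_2}I_m(g_m)\big)=\sum_{n\le N_1}\sum_{m\le N_2}I_{n+m}(f_n\hat\otimes g_m)$, where $\hat\otimes$ is the symmetric tensor product. For general $F=\sum_nI_n(f_n)$, $G=\sum_mI_m(g_m)$, put $F_N=\sum_{n\le N}I_n(f_n)$, $G_N=\sum_{m\le N}I_m(g_m)$; $F\diamond G$ exists in $L^2$ if $F_N\diamond G_N$ converges in $L^2$, and then $F\diamond G$ is the limit. *)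

(* Defs.v *)
From HB Require Import structures.
From mathcomp Require Import all_boot all_order all_algebra all_fingroup.
From mathcomp Require Import sesquilinear.
From mathcomp Require Import all_classical all_reals all_analysis.

Set Implicit Arguments.
Unset Strict Implicit.
Unset Printing Implicit Defensive.

Import Order.TTheory GRing.Theory Num.Theory.
Import numFieldNormedType.Exports.

Local Open Scope classical_set_scope.
Local Open Scope ring_scope.

Definition L2_cvg {d} {T : measurableType d} {R : realType}
    (mu : probability T R) (X_ : nat -> T -> R) (X : T -> R) : Prop :=
  Lnorm mu 2%:E (EFin \o (fun x => X_ N x - X x)) @[N --> \oo] --> 0%E.

Notation borel B := (g_sigma_algebraType (@open B)).

Record dual {R : realType} (B : normedModType R) := Dual {
  dual_form :> {scalar B} ;
  dual_continuous : continuous (dual_form : B -> R) }.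

(* The characteristic functional of the measure is real-valued, so it is stated
   through its real and imaginary parts; at l = 0 it forces total mass 1, which
   is why the measure is typed as a probability. *)
Record abstract_wiener_space (R : realType) := AbstractWienerSpace {
  aws_H : completeNormedModType R ;
  aws_ip : {dot aws_H for idfun} ;
  aws_ip_norm : forall h, aws_ip h h = `|h| ^+ 2 ;
  aws_separable : exists2 D : set aws_H, countable D & dense D ;
  aws_B : completeNormedModType R ;
  aws_embed : {linear aws_H -> aws_B} ;
  aws_embed_inj : injective aws_embed ;
  aws_embed_continuous : continuous aws_embed ;
  aws_embed_dense : dense (range aws_embed) ;
  (* B' as a subspace of H: transpose of the embedding, after Riesz *)
  aws_dual : dual aws_B -> aws_H ;
  aws_dualE : forall l h, aws_ip (aws_dual l) h = l (aws_embed h) ;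
  aws_dual_dense : dense (range aws_dual) ;
  aws_mu : probability (borel aws_B) R ;
  aws_mu_cos : forall l : dual aws_B,
    ('E_aws_mu[fun x => cos (l x)] = (expR (- (`|aws_dual l| ^+ 2 / 2)))%:E)%E ;
  aws_mu_sin : forall l : dual aws_B,
    ('E_aws_mu[fun x => sin (l x)] = 0)%E }.

(* An element of the n-fold Hilbert tensor power is represented by an n-linear
   form of Hilbert-Schmidt class, h_1 (x) ... (x) h_n being the form
   k |-> \prod_i <h_i, k_i>.  Its norm is (\sum_i f(e_i1, ..., e_in)^2)^(1/2)
   for any orthonormal basis e; taking instead the supremum over all finite
   orthonormal families gives the same value and avoids choosing a basis. *)

Section tensor.
Context {R : realType} {H : completeNormedModType R} (ip : {dot H for idfun}).

Definition orthonormal_family d (e : 'I_d -> H) : Prop :=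
  forall i j, ip (e i) (e j) = (i == j)%:R.

Definition hs_norm2 n (f : ('I_n -> H) -> R) : \bar R :=
  ereal_sup [set y | exists d, exists2 e : 'I_d -> H, orthonormal_family e &
    y = (\sum_(i : {ffun 'I_n -> 'I_d}) f (fun k => e (i k)) ^+ 2)%:E].

Definition multilinear_form n (f : ('I_n -> H) -> R) : Prop :=
  forall (i : 'I_n) (h : 'I_n -> H) (a : R) (u v : H),
    f [eta h with i |-> a *: u + v] =
    a * f [eta h with i |-> u] + f [eta h with i |-> v].

Definition symmetric_form n (f : ('I_n -> H) -> R) : Prop :=
  forall (s : 'S_n) (h : 'I_n -> H), f (h \o s) = f h.

Definition sym_tensor n (f : ('I_n -> H) -> R) : Prop :=
  [/\ multilinear_form f, symmetric_form f & (hs_norm2 f < +oo)%E].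

Definition tensor_pow n (h : H) : ('I_n -> H) -> R :=
  fun k => \prod_(i < n) ip h (k i).

Definition symmetrize n (f : ('I_n -> H) -> R) : ('I_n -> H) -> R :=
  fun h => (n`!%:R)^-1 * \sum_(s : 'S_n) f (h \o s).

Definition tensor_prod n m (f : ('I_n -> H) -> R) (g : ('I_m -> H) -> R) :
    ('I_(n + m) -> H) -> R :=
  fun h => f (fun i => h (lshift m i)) * g (fun j => h (rshift n j)).

Definition sym_prod n m (f : ('I_n -> H) -> R) (g : ('I_m -> H) -> R) :
    ('I_(n + m) -> H) -> R :=
  symmetrize (tensor_prod f g).

End tensor.

Definition hermite {R : realType} (n : nat) (x : R) : R :=
  (-1) ^+ n * expR (x ^+ 2 / 2) *
  derive1n n (fun y : R => expR (- (y ^+ 2 / 2))) x.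

Section wick.
Context {R : realType} (W : abstract_wiener_space R).
Local Notation H := (aws_H W).
Local Notation B := (borel (aws_B W)).
Local Notation mu := (aws_mu W).
Local Notation ip := (aws_ip W).

(* h |-> tilde h, a version of the L^2-extension of l |-> <l, .> from B' to H *)
Record gaussian_extension (tilde : H -> B -> R) : Prop := GaussianExtension {
  tilde_L2 : forall h, tilde h \in Lfun mu 2%:E ;
  tilde_cvg : forall (l_ : nat -> dual (aws_B W)) (h : H),
    aws_dual (l_ k) @[k --> \oo] --> h ->
    L2_cvg mu (fun k x => l_ k x) (tilde h) }.

(* I n f is a version of I_n(f) for f in the n-th symmetric tensor power; the
   values of I n at other f are irrelevant.  The case n = 0 is stated separately
   because the formula on powers says nothing about it when H is trivial. *)
Record multiple_integral (tilde : H -> B -> R)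
    (I : forall n, (('I_n -> H) -> R) -> B -> R) : Prop := MultipleIntegral {
  mi_L2 : forall n (f : ('I_n -> H) -> R),
    sym_tensor ip f -> I n f \in Lfun mu 2%:E ;
  mi_linear : forall n (a : R) (f g : ('I_n -> H) -> R),
    sym_tensor ip f -> sym_tensor ip g ->
    I n (fun h => a * f h + g h) = (fun x => a * I n f x + I n g x) %[ae mu] ;
  mi_continuous : forall n, exists C : R, forall f : ('I_n -> H) -> R,
    sym_tensor ip f ->
    ('E_mu[fun x => (I n f x ^+ 2)%R] <= C%:E * hs_norm2 ip f)%E ;
  mi_pow : forall n (h : H), h != 0 ->
    I n (tensor_pow ip h) =
    (fun x => `|h| ^+ n * hermite n (tilde h x / `|h|)) %[ae mu] ;
  mi_const : forall (f : ('I_0 -> H) -> R),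
    I 0 f = (fun=> f (fun=> 0)) %[ae mu] }.

Variable I : forall n, (('I_n -> H) -> R) -> B -> R.

Definition chaos_expansion (F : B -> R)
    (f : forall n, ('I_n -> H) -> R) : Prop :=
  (forall n, sym_tensor ip (f n)) /\
  L2_cvg mu (fun N x => \sum_(n < N.+1) I (f n) x) F.

Definition second_quantization_in_L2 (alpha : R) (F : B -> R) : Prop :=
  exists2 f : (forall n, ('I_n -> H) -> R), chaos_expansion F f &
  (\sum_(0 <= n <oo) (n`!%:R * alpha ^+ (2 * n))%:E * hs_norm2 ip (f n)
    < +oo)%E.

Definition wick_finite (f g : forall n, ('I_n -> H) -> R) (N1 N2 : nat) :
    B -> R :=
  fun x => \sum_(n < N1.+1) \sum_(m < N2.+1) I (sym_prod (f n) (g m)) x.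

Definition is_wick_product (F G X : B -> R) : Prop :=
  exists f g : (forall n, ('I_n -> H) -> R),
  [/\ chaos_expansion F f, chaos_expansion G g &
      L2_cvg mu (fun N => wick_finite f g N N) X].

Definition wick_product_exists (F G : B -> R) : Prop :=
  exists2 X : B -> R, X \in Lfun mu 2%:E & is_wick_product F G X.

End wick.

(* Main.v *)
From HB Require Import structures.
Require Import Defs.
From mathcomp Require Import all_boot all_order all_algebra all_fingroup.
From mathcomp Require Import sesquilinear ring lra zify.
From mathcomp Require Import all_classical all_reals all_analysis.
From mathcomp Require Import measurable_realfun.
Import Order.TTheory GRing.Theory Num.Theory.
Import numFieldNormedType.Exports.
Local Open Scope classical_set_scope.
Local Open Scope ring_scope.

(** If I_n is bounded by sqrt(n!) and has orthogonal ranges for distinct n, then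
    with a_n = |f_n| and b_m = |g_m| the Cauchy-Schwarz inequality with the
    weights C(n+m, n) p^(-2n) q^(-2m), which sum to (1/p^2 + 1/q^2)^k = 1 over
    n + m = k, gives
      k! (sum_(n+m=k) a_n b_m)^2 <= sum_(n+m=k) n! p^(2n) a_n^2 m! q^(2m) b_m^2,
    so that the partial Wick products form a Cauchy sequence in L^2.

    The bound and the orthogonality come from the values of I_n on powers.
    Differentiating the joint characteristic function of a Gaussian pair (X, Z)
    gives the integration by parts formula E[X phi(Z)] = cov(X, Z) E[phi'(Z)] for
    phi(z) = z^n cos(tz), z^n sin(tz), first for small n; Fatou's lemma turns it
    into the existence of all moments, hence into the formula for polynomials,
    and the recurrence H_(n+1) = x H_n - H_n' then yields
    E[H_n(X) H_m(Z)] = [n = m] n! cov(X, Z)^n for unit variances.  A symmetric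
    Hilbert-Schmidt form is the limit of its compressions to finite orthonormal
    families, which are linear combinations of powers by polarization. *)

Set Implicit Arguments.
Unset Strict Implicit.
Unset Printing Implicit Defensive.

(** * Expectations *)

(** What is given about [I] is its values on powers and constants, linearity, and in each order a
    continuity constant of unspecified size; neither the factor n! nor the orthogonality is assumed,
    so both must come from the law of [tilde]. That law is accessible only through characteristic
    functions, and an L^2 limit brings no more than square integrability. The classical shortcut,
    expanding the expectation of a product of two exponentials exp(sX - s^2/2) in powers of the
    parameters, would first require exponential moments. Trigonometric test functions are bounded,
    so that differentiating under the expectation costs a single moment at each order, and the
    moments can be produced along the way. The unspecified continuity constant does no harm: it only
    serves to pass to the limit. On the compression of a form to a finite orthonormal family the
    second moment is computed exactly, with the factor n!, and this factor survives the limit. *)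

Section expectation.
Context {d} {T : measurableType d} {R : realType} (P : probability T R).
Implicit Types f g : T -> R.

Definition intg f := P.-integrable setT (EFin \o f).
Definition expect f : R := \int[P]_x f x.

Lemma intg_measurable {f} : intg f -> measurable_fun setT f.
Proof. by move=> /integrableP[/measurable_EFinP]. Qed.

Lemma intg_le f g : measurable_fun setT f -> intg g ->
  (forall x, `|f x| <= g x) -> intg f.
Proof.
move=> mf ig fg; apply: (le_integrable measurableT _ _ ig).
  exact/measurable_EFinP.
by move=> x _ /=; rewrite lee_fin (le_trans (fg x))// ler_norm.
Qed.

Lemma intg_cst c : intg (fun=> c).
Proof. exact: finite_measure_integrable_cst. Qed.

Lemma intgD f g : intg f -> intg g -> intg (fun x => f x + g x).
Proof. by move=> hf hg; exact: (integrableD measurableT hf hg). Qed.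

Lemma intgB f g : intg f -> intg g -> intg (fun x => f x - g x).
Proof. by move=> hf hg; exact: (integrableB measurableT hf hg). Qed.

Lemma intgZ c f : intg f -> intg (fun x => c * f x).
Proof. by move=> hf; exact: (integrableZl measurableT c hf). Qed.

Lemma intg_norm f : intg f -> intg (fun x => `|f x|).
Proof.
by move=> hf; exact: (integrable_abse hf).
Qed.

Lemma intg_sum (I : Type) (s : seq I) (Q : pred I) (F : I -> T -> R) :
  (forall i, Q i -> intg (F i)) -> intg (fun x => \sum_(i <- s | Q i) F i x).
Proof.
move=> iF; elim: s => [|i s ih].
  rewrite (_ : (fun _ => _) = fun=> 0); first exact: intg_cst.
  by apply/funext => x; rewrite big_nil.
case Qi: (Q i); last by under eq_fun do rewrite big_cons Qi.
by under eq_fun do rewrite big_cons Qi; apply: intgD => //; exact: iF.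
Qed.

Lemma expect_cst c : expect (fun=> c) = c.
Proof. by rewrite /expect Rintegral_cst//= probability_setT mulr1. Qed.

Lemma expectD f g : intg f -> intg g ->
  expect (fun x => f x + g x) = expect f + expect g.
Proof. by move=> ? ?; exact: RintegralD. Qed.

Lemma expectB f g : intg f -> intg g ->
  expect (fun x => f x - g x) = expect f - expect g.
Proof. by move=> ? ?; exact: RintegralB. Qed.

Lemma expectZ c f : intg f -> expect (fun x => c * f x) = c * expect f.
Proof. by move=> ?; exact: RintegralZl. Qed.

Lemma expect_sum (I : Type) (s : seq I) (Q : pred I) (F : I -> T -> R) :
  (forall i, Q i -> intg (F i)) ->
  expect (fun x => \sum_(i <- s | Q i) F i x) = \sum_(i <- s | Q i) expect (F i).
Proof.
move=> iF; elim: s => [|i s ih].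
  rewrite big_nil -[RHS]expect_cst; congr expect.
  by apply/funext => x; rewrite big_nil.
rewrite big_cons -ih; case Qi: (Q i); last by under eq_fun do rewrite big_cons Qi.
under eq_fun do rewrite big_cons Qi.
by apply: expectD; [exact: iF|exact: intg_sum].
Qed.

Lemma expect_le f g : intg f -> intg g -> (forall x, f x <= g x) ->
  expect f <= expect g.
Proof. by move=> ? ? fg; apply: le_Rintegral => // x _; exact: fg. Qed.

Lemma expect_ge0 f : (forall x, 0 <= f x) -> 0 <= expect f.
Proof. by move=> f0; apply: Rintegral_ge0 => x _; exact: f0. Qed.

Lemma EFin_expect f : intg f -> ((expect f)%:E = \int[P]_x (f x)%:E)%E.
Proof. by move=> h; rewrite fineK//; exact: integrable_fin_num. Qed.

Lemma intgMcos f (g : T -> R) : intg f -> measurable_fun setT g ->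
  intg (fun x => f x * cos (g x)).
Proof.
move=> i m; have := intg_measurable i => mf; apply: intg_le (intg_norm i) _.
  apply: measurable_funM => //; apply: measurableT_comp m.
  by apply: continuous_measurable_fun; exact: continuous_cos.
by move=> x; rewrite normrM ler_piMr// ler_norml cos_geN1 cos_le1.
Qed.

Lemma intgMsin f (g : T -> R) : intg f -> measurable_fun setT g ->
  intg (fun x => f x * sin (g x)).
Proof.
move=> i m; have := intg_measurable i => mf; apply: intg_le (intg_norm i) _.
  apply: measurable_funM => //; apply: measurableT_comp m.
  by apply: continuous_measurable_fun; exact: continuous_sin.
by move=> x; rewrite normrM ler_piMr// ler_norml sin_geN1 sin_le1.
Qed.

Lemma is_derive_expect (f f' : R -> T -> R) (G : T -> R) (a : R) :
  (forall t, intg (f t)) -> intg G ->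
  (forall (t : R) x, is_derive t 1 (f ^~ x : R -> R) (f' t x)) ->
  (forall t x, `|f' t x| <= G x) ->
  is_derive a 1 (fun t => expect (f t)) (expect (f' a)).
Proof.
move=> intf iG df fG.
have d1E t x : partial1of2 f t x = f' t x.
  by rewrite partial1of2E; have := df t x => -[_ ->].
have G0 x : 0 <= G x by apply: le_trans (fG a x).
(* The domination by [G] is uniform in [t], so any neighbourhood of [a] would do. *)
have Ia : (`]a - 1, a + 1[%classic : set R) a.
  by rewrite /= in_itv/=; apply/andP; split; lra.
have h1 : forall t, `]a - 1, a + 1[%classic t -> intg (f t) by move=> t _; exact: intf.
have h2 : forall t y, `]a - 1, a + 1[%classic t -> setT y -> derivable (f ^~ y) t 1.
  by move=> t y _ _; have [] := df t y.
have h3 : forall t y, `]a - 1, a + 1[%classic t -> setT y -> `|partial1of2 f t y| <= G y.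
  by move=> t y _ _; rewrite d1E.
apply: DeriveDef.
  exact: (derivable_under_integral measurableT Ia h1 h2 G0 iG h3).
have := differentiation_under_integral measurableT Ia h1 h2 G0 iG h3.
rewrite derive1E => ->; apply: eq_Rintegral => x _.
by rewrite d1E.
Qed.

(** The phase [W] leaves room for a second variable: with [W = 0] the derivative raises a moment of
    [Z], and with another variable in [W] the derivative at [t = 0] brings down one factor of a
    joint characteristic function. *)
Lemma is_derive_expect_cos (A Z W : T -> R) (t : R) :
  intg A -> intg (fun x => A x * Z x) ->
  measurable_fun setT Z -> measurable_fun setT W ->
  is_derive t 1 (fun t => expect (fun x => A x * cos (t * Z x + W x)))
    (- expect (fun x => A x * Z x * sin (t * Z x + W x))).
Proof.
move=> iA iAZ mZ mW.
have mtZW s : measurable_fun setT (fun x => s * Z x + W x).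
  by apply: measurable_funD => //; apply: measurable_funM.
rewrite -mulN1r -expectZ; last exact: intgMsin.
apply: (@is_derive_expect (fun t x => A x * cos (t * Z x + W x))
  (fun t x => -1 * (A x * Z x * sin (t * Z x + W x)))
  (fun x => `|A x * Z x|)).
- by move=> s; exact: intgMcos.
- exact: intg_norm.
- move=> s x; apply: is_derive_eq.
  by rewrite !(scaler0, addr0) /GRing.scale/=; ring.
- move=> s x; rewrite mulN1r normrN normrM ler_piMr// ler_norml.
  by rewrite sin_geN1 sin_le1.
Qed.

Lemma is_derive_expect_sin (A Z W : T -> R) (t : R) :
  intg A -> intg (fun x => A x * Z x) ->
  measurable_fun setT Z -> measurable_fun setT W ->
  is_derive t 1 (fun t => expect (fun x => A x * sin (t * Z x + W x)))
    (expect (fun x => A x * Z x * cos (t * Z x + W x))).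
Proof.
move=> iA iAZ mZ mW.
have mtZW s : measurable_fun setT (fun x => s * Z x + W x).
  by apply: measurable_funD => //; apply: measurable_funM.
apply: (@is_derive_expect (fun t x => A x * sin (t * Z x + W x))
  (fun t x => A x * Z x * cos (t * Z x + W x))
  (fun x => `|A x * Z x|)).
- by move=> s; exact: intgMsin.
- exact: intg_norm.
- move=> s x; apply: is_derive_eq.
  by rewrite !(scaler0, addr0) /GRing.scale/=; ring.
- move=> s x; rewrite normrM ler_piMr// ler_norml.
  by rewrite cos_geN1 cos_le1.
Qed.

End expectation.

(** * Gaussian integration by parts *)

Section stein.
Context {d} {T : measurableType d} {R : realType} (P : probability T R).
Implicit Types X Z : T -> R.
Local Notation E := (expect P).
Local Notation intg := (intg P).

Lemma is_derive_moment_cos X Z (n : nat) (t : R) : measurable_fun setT Z ->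
  intg (fun x => X x * Z x ^+ n) -> intg (fun x => X x * Z x ^+ n.+1) ->
  is_derive t 1 (fun t : R => E (fun x => X x * Z x ^+ n * cos (t * Z x)))
    (- E (fun x => X x * Z x ^+ n.+1 * sin (t * Z x))).
Proof.
move=> mZ i1 i2; have W0 : measurable_fun (setT : set T) (fun=> 0 : R) by [].
rewrite (_ : (fun x => X x * Z x ^+ n.+1) =
  (fun x => X x * Z x ^+ n * Z x)) in i2; last first.
  by apply/funext => x; rewrite exprSr mulrA.
have := is_derive_expect_cos t i1 i2 mZ W0.
set F := (X in is_derive _ _ X) => h.
rewrite (_ : (fun _ => _) = F); last first.
  by apply/funext => s; congr expect; apply/funext => x; rewrite addr0.
apply: is_derive_eq; congr (- expect _ _); apply/funext => x.
by rewrite addr0 exprSr mulrA.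
Qed.

Lemma is_derive_moment_sin X Z (n : nat) (t : R) : measurable_fun setT Z ->
  intg (fun x => X x * Z x ^+ n) -> intg (fun x => X x * Z x ^+ n.+1) ->
  is_derive t 1 (fun t : R => E (fun x => X x * Z x ^+ n * sin (t * Z x)))
    (E (fun x => X x * Z x ^+ n.+1 * cos (t * Z x))).
Proof.
move=> mZ i1 i2; have W0 : measurable_fun (setT : set T) (fun=> 0 : R) by [].
rewrite (_ : (fun x => X x * Z x ^+ n.+1) =
  (fun x => X x * Z x ^+ n * Z x)) in i2; last first.
  by apply/funext => x; rewrite exprSr mulrA.
have := is_derive_expect_sin t i1 i2 mZ W0.
set F := (X in is_derive _ _ X) => h.
rewrite (_ : (fun _ => _) = F); last first.
  by apply/funext => s; congr expect; apply/funext => x; rewrite addr0.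
apply: is_derive_eq; congr (expect _ _); apply/funext => x.
by rewrite addr0 exprSr mulrA.
Qed.

(** The two hypotheses are integration by parts against cos(tz) and sin(tz). Each derivative in [t]
    exchanges the two functions and adds a factor [Z], so [n] derivatives reach z^n cos(tz) and z^n
    sin(tz). Integrability is asked only up to order [n] because [gaussian_moments] applies the
    lemma before higher moments are known. *)
Lemma trig_stein X Z (k : R) : measurable_fun setT Z ->
  (forall t, E (fun x => X x * cos (t * Z x)) =
     - (k * t * E (fun x => sin (t * Z x)))) ->
  (forall t, E (fun x => X x * sin (t * Z x)) =
     k * t * E (fun x => cos (t * Z x))) ->
  forall n,
  (forall i, (i <= n)%N -> intg (fun x => X x * Z x ^+ i)) ->
  (forall i, (i <= n)%N -> intg (fun x => Z x ^+ i)) ->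
  forall t,
  E (fun x => X x * Z x ^+ n * cos (t * Z x)) =
    k * (n%:R * E (fun x => Z x ^+ n.-1 * cos (t * Z x))
         - t * E (fun x => Z x ^+ n * sin (t * Z x))) /\
  E (fun x => X x * Z x ^+ n * sin (t * Z x)) =
    k * (n%:R * E (fun x => Z x ^+ n.-1 * sin (t * Z x))
         + t * E (fun x => Z x ^+ n * cos (t * Z x))).
Proof.
move=> mZ Hc Hs; elim => [|n ih] iX iZ t.
  have z0 (f : R -> R) : (fun x => Z x ^+ 0 * f (t * Z x)) = (fun x => f (t * Z x)).
    by apply/funext => x; rewrite expr0 mul1r.
  rewrite !mul0r sub0r add0r (z0 sin) (z0 cos) mulrN !mulrA -Hs -Hc.
  by split; congr expect; apply/funext => x; rewrite expr0 mulr1.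
have {}ih := ih (fun i l => iX i (leqW l)) (fun i l => iZ i (leqW l)).
have one f : (fun x => 1 * (f x : R)) = f :> (T -> R).
  by apply/funext => x; rewrite mul1r.
have one2 m (f : R -> R) t' : E (fun x => 1 * Z x ^+ m * f (t' * Z x)) =
    E (fun x => Z x ^+ m * f (t' * Z x)).
  by congr expect; apply/funext => x; rewrite mul1r.
have iZ1 i : (i <= n.+1)%N -> intg (fun x => 1 * Z x ^+ i).
  by move=> l; rewrite one; exact: iZ.
have dZc m (s : R) : (m <= n)%N -> is_derive s 1 (fun t : R => E (fun x => Z x ^+ m * cos (t * Z x)))
    (- E (fun x => Z x ^+ m.+1 * sin (s * Z x))).
  move=> lm; have := is_derive_moment_cos (X := fun=> 1) s mZ (iZ1 m (leqW lm)) (iZ1 m.+1 lm).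
  have e := one2 m cos; rewrite (funext e) => D; apply: is_derive_eq.
  by rewrite one2.
have dZs m (s : R) : (m <= n)%N -> is_derive s 1 (fun t : R => E (fun x => Z x ^+ m * sin (t * Z x)))
    (E (fun x => Z x ^+ m.+1 * cos (s * Z x))).
  move=> lm; have := is_derive_moment_sin (X := fun=> 1) s mZ (iZ1 m (leqW lm)) (iZ1 m.+1 lm).
  have e := one2 m sin; rewrite (funext e) => D; apply: is_derive_eq.
  by rewrite one2.
have dXc := is_derive_moment_cos t mZ (iX n (leqnSn n)) (iX _ (leqnn _)).
have dXs := is_derive_moment_sin t mZ (iX n (leqnSn n)) (iX _ (leqnn _)).
(* At [n = 0] the truncated predecessor would break the rule for differentiating [Z ^+ n.-1]; there
   the factor [n%:R] makes the function constantly 0. *)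
have predc (s : R) : is_derive s 1 (fun t : R => n%:R * E (fun x => Z x ^+ n.-1 * cos (t * Z x)))
   (- (n%:R * E (fun x => Z x ^+ n * sin (s * Z x)))).
  case: n {ih iX iZ iZ1 dXc dXs} dZc dZs => [|n] dZc dZs.
    rewrite mul0r oppr0 (_ : (fun _ => _) = cst 0); first exact: is_derive_cst.
    by apply/funext => u; rewrite mul0r.
  have := dZc n s (leqnSn n) => D; apply: is_derive_eq.
  by rewrite ?(scaler0, addr0) /GRing.scale/= ; ring.
have preds (s : R) : is_derive s 1 (fun t : R => n%:R * E (fun x => Z x ^+ n.-1 * sin (t * Z x)))
   ((n%:R * E (fun x => Z x ^+ n * cos (s * Z x)))).
  case: n {ih iX iZ iZ1 dXc dXs predc} dZc dZs => [|n] dZc dZs.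
    rewrite mul0r (_ : (fun _ => _) = cst 0); first exact: is_derive_cst.
    by apply/funext => u; rewrite mul0r.
  have := dZs n s (leqnSn n) => D; apply: is_derive_eq.
  by rewrite ?(scaler0, addr0) /GRing.scale/= ; ring.
have Ec : (fun t => E (fun x => X x * Z x ^+ n * cos (t * Z x))) =
  (fun t => k * (n%:R * E (fun x => Z x ^+ n.-1 * cos (t * Z x))
         - t * E (fun x => Z x ^+ n * sin (t * Z x)))).
  by apply/funext => s; have [] := ih s.
have Es : (fun t => E (fun x => X x * Z x ^+ n * sin (t * Z x))) =
  (fun t => k * (n%:R * E (fun x => Z x ^+ n.-1 * sin (t * Z x))
         + t * E (fun x => Z x ^+ n * cos (t * Z x)))).
  by apply/funext => s; have [] := ih s.
rewrite Ec in dXc; rewrite Es in dXs.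
have dc := dZc n t (leqnn n); have ds := dZs n t (leqnn n).
have pc := predc t; have ps := preds t.
have [_ hs] := dXs; have [_ hc] := dXc; clear dXs dXc.
(* The derivative of the sine identity of order [n] is the cosine identity of order [n.+1], and
   conversely up to a sign. *)
split; last apply: oppr_inj.
- rewrite -hs derive_val ?(scaler0, addr0) /GRing.scale/= -natr1; ring.
- rewrite -hc derive_val ?(scaler0, addr0) /GRing.scale/= -natr1; ring.
Qed.

End stein.

(** * Lipschitz bounds and the difference quotient of the sine *)

Section trig_bounds.
Context {R : realType}.
Implicit Types x y : R.

Lemma lipschitz1_derive (f f' : R -> R) :
  (forall x, is_derive x 1 f (f' x)) -> (forall x, `|f' x| <= 1) ->
  forall x y, `|f x - f y| <= `|x - y|.
Proof.
move=> df f1.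
have main x y : x < y -> `|f y - f x| <= `|y - x|.
  move=> xy; have [|c _ ->] := @MVT R f f' x y xy (fun z _ => df z).
    by apply: derivable_within_continuous => z _; have [] := df z.
  by rewrite normrM ler_piMl.
move=> x y; have [xy|yx|->] := ltgtP x y; last by rewrite !subrr.
  by rewrite distrC [leRHS]distrC main.
exact: main.
Qed.

Lemma sin_lipschitz x y : `|sin x - sin y| <= `|x - y|.
Proof. by apply: (@lipschitz1_derive _ cos) => z; exact: cos_max. Qed.

Lemma cos_lipschitz x y : `|cos x - cos y| <= `|x - y|.
Proof.
apply: (@lipschitz1_derive _ (fun z => - sin z)) => z.
by rewrite normrN sin_max.
Qed.

Lemma ler_abs_sin x : `|sin x| <= `|x|.
Proof. by have := sin_lipschitz x 0; rewrite sin0 !subr0. Qed.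

Lemma cvg_sin_quotient y :
  sin (n.+1%:R^-1 * y) / n.+1%:R^-1 @[n --> \oo] --> y.
Proof.
have d : is_derive (0 : R) 1 (fun s => sin (s * y)) y.
  by apply: is_derive_eq; rewrite ?(scaler0, mul0r, addr0) /GRing.scale/= cos0; ring.
have [dv e] := d.
have h : h^-1 *: (sin ((h *: 1 + 0) * y) - sin (0 * y)) @[h --> (0:R)^'] --> y.
  by rewrite -[X in _ --> X]e; exact: dv.
have hs := (cvgr_dnbhsP _ _ _).1 h (fun n => n.+1%:R^-1).
rewrite (_ : (fun n => _) = fun n : nat => n.+1%:R^-1^-1 *:
  (sin ((n.+1%:R^-1 *: 1 + 0) * y) - sin (0 * y))).
  apply: hs; split; last exact: cvg_harmonic.
  by move=> n; rewrite invr_eq0 pnatr_eq0.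
apply/funext => n; rewrite mul0r sin0 subr0 addr0 /GRing.scale/= mulr1 mulrC.
by [].
Qed.

End trig_bounds.

(** * Existence of the moments of Gaussian variables *)

Section moments.
Context {d} {T : measurableType d} {R : realType} (P : probability T R).
Implicit Types X Z : T -> R.
Local Notation E := (expect P).
Local Notation intg := (intg P).

(** Integrability of the limit is part of the conclusion: this is how new moments, and later the L^2
    limit, are obtained. The bound is only eventual because in [L2_complete] it holds for late
    indices alone. *)
Lemma fatou_intg (f : nat -> T -> R) (g : T -> R) (C : R) :
  (forall n, intg (f n)) -> (forall n x, 0 <= f n x) ->
  measurable_fun setT g -> (forall x, 0 <= g x) ->
  {ae P, forall x, f n x @[n --> \oo] --> g x} ->
  (\forall n \near \oo, E (f n) <= C) ->
  intg g /\ E g <= C.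
Proof.
move=> iF f0 mg g0 fg fC.
have mf n : measurable_fun setT (fun x => (f n x)%:E).
  by apply/measurable_EFinP; exact: intg_measurable (iF n).
have gC : (\int[P]_x (g x)%:E <= C%:E)%E.
  apply: (@le_trans _ _ (\int[P]_x (limn_einf (fun n => (f n x)%:E)))%E).
    apply: ae_ge0_le_integral => //.
    - by move=> x _; rewrite lee_fin.
    - exact/measurable_EFinP.
    - move=> x _; rewrite limn_einf_lim; apply: lime_ge; first exact: is_cvg_einfs.
      apply: nearW => n; apply: le_ereal_inf_tmp => _ [m _ <-].
      by rewrite lee_fin.
    - have me := @measurable_fun_einfs _ _ _ _ (fun n x => (f n x)%:E) mf.
      apply: (emeasurable_fun_cvg _ _ me) => x _.
      by rewrite limn_einf_lim; exact: is_cvg_einfs.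
    - apply: filterS fg => x fx _.
      have h : (f n x)%:E @[n --> \oo] --> (g x)%:E.
        by apply: cvg_EFin fx; exact: nearW.
      by rewrite (cvg_limn_einf_sup h).1.
  apply: (le_trans (fatou _ _ _ _)) => //.
    by move=> n x _; rewrite lee_fin.
  rewrite limn_einf_lim; apply: lime_le; first exact: is_cvg_einfs.
  have [N _ NC] := fC; apply: nearW => n.
  (* The infimum over indices from [n] on is bounded by its value at one index that is also past
     [N]. *)
  apply: (@le_trans _ _ (\int[P]_x (f (maxn n N) x)%:E)%E).
    by apply: ereal_inf_lbound; exists (maxn n N) => //=; exact: leq_maxl.
  rewrite -EFin_expect// lee_fin; apply: NC; exact: leq_maxr.
have ig : intg g.
  apply/integrableP; split; first exact/measurable_EFinP.
  under eq_integral => x _ do rewrite /= ger0_norm//.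
  exact: le_lt_trans gC (ltry _).
by split => //; rewrite -lee_fin EFin_expect.
Qed.

(* [X] has variance [b], [Z] has variance [a], and [k] is their covariance. *)
Definition gaussian_pair (X Z : T -> R) (b k a : R) : Prop :=
  forall t u,
  E (fun x => cos (t * Z x + u * X x)) =
    expR (- ((t ^+ 2 * a + 2 * t * u * k + u ^+ 2 * b) / 2)) /\
  E (fun x => sin (t * Z x + u * X x)) = 0.

(** Differentiate the joint characteristic function in [u] at [u = 0]. Only the first moment of [X]
    is needed, so this can start the induction on moments. *)
Lemma gaussian_pair_trig X Z (b k a : R) :
  intg X -> measurable_fun setT Z -> gaussian_pair X Z b k a ->
  forall t,
  E (fun x => X x * cos (t * Z x)) = - (k * t * E (fun x => sin (t * Z x))) /\
  E (fun x => X x * sin (t * Z x)) = k * t * E (fun x => cos (t * Z x)).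
Proof.
move=> iX mZ g t; have mX := intg_measurable iX.
have mW : measurable_fun setT (fun x => t * Z x) by exact: measurable_funM.
have i1 : intg (fun=> 1) by exact: intg_cst.
have iX1 : intg (fun x => 1 * X x) by exact: intgZ.
have z0 (f : R -> R) : (fun x => f (t * Z x)) = (fun x => f (t * Z x + 0 * X x)).
  by apply/funext => x; rewrite mul0r addr0.
have e0 : E (fun x => cos (t * Z x)) = expR (- (t ^+ 2 * a / 2)).
  rewrite z0 (g t 0).1; congr (expR (- (_ / 2))); ring.
have e1 : E (fun x => sin (t * Z x)) = 0 by rewrite z0 (g t 0).2.
have sw (f : R -> R) u : E (fun x => 1 * f (u * X x + t * Z x)) = E (fun x => f (t * Z x + u * X x)).
  by congr expect; apply/funext => x; rewrite mul1r addrC.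
split.
  have := @is_derive_expect_sin _ _ _ P (fun=> 1) X _ 0 i1 iX1 mX mW.
  have -> : (fun t0 : R => E (fun x => 1 * sin (t0 * X x + t * Z x))) = cst 0.
    by apply/funext => u; rewrite sw (g t u).2.
  move=> [_]; rewrite derive_val e1 mulr0 oppr0 => ->.
  by congr expect; apply/funext => x; rewrite mul1r mul0r add0r.
have := @is_derive_expect_cos _ _ _ P (fun=> 1) X _ 0 i1 iX1 mX mW.
have -> : (fun t0 : R => E (fun x => 1 * cos (t0 * X x + t * Z x))) =
  (fun u => expR (- ((t ^+ 2 * a + 2 * t * u * k + u ^+ 2 * b) / 2))).
  by apply/funext => u; rewrite sw (g t u).1.
move=> [_]; rewrite derive_val e0.
rewrite ?(scaler0, addr0) /GRing.scale/=.
under [in X in _ = X -> _]eq_fun do rewrite mul1r mul0r add0r.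
move=> h; apply: oppr_inj; rewrite -h expr0n/= mul0r addr0 mulr0 mul0r addr0.
by field.
Qed.

Lemma intg_exp_le Z (m n : nat) : measurable_fun setT Z ->
  intg (fun x => Z x ^+ m.*2) -> (n <= m.*2)%N -> intg (fun x => Z x ^+ n).
Proof.
move=> mZ im nm; apply: intg_le (intgD (intg_cst P 1) im) _.
  exact: measurable_funX.
move=> x; rewrite -mul2n exprM.
have Zm : 0 <= (Z x ^+ 2) ^+ m by rewrite exprn_ge0// sqr_ge0.
rewrite normrX; have [Z1|Z1] := lerP `|Z x| 1.
  by rewrite (le_trans (exprn_ile1 _ _ _))// lerDl.
rewrite (le_trans (y := `|Z x| ^+ m.*2))//.
  by rewrite ler_weXn2l// ltW.
by rewrite -mul2n exprM real_normK ?num_real// lerDr.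
Qed.

Lemma gaussian_moments Z (a : R) :
  measurable_fun setT Z -> intg (fun x => Z x ^+ 2) -> 0 <= a ->
  gaussian_pair Z Z a a a -> forall n, intg (fun x => Z x ^+ n).
Proof.
move=> mZ iZ2 a0 g.
have iZ : intg Z by have := @intg_exp_le Z 1 1 mZ iZ2 isT.
have tr := gaussian_pair_trig iZ mZ g.
suff even k : intg (fun x => Z x ^+ k.+1.*2).
  move=> n; apply: (@intg_exp_le Z n.+1) => //.
  by rewrite -addnn; lia.
elim: k => [//|k ih].
have iZn i : (i <= k.+1.*2)%N -> intg (fun x => Z x ^+ i).
  by move=> ik; apply: (@intg_exp_le Z k.+1).
have iZZ i : (i <= k.*2.+1)%N -> intg (fun x => Z x * Z x ^+ i).
  by move=> ik; under eq_fun do rewrite -exprS; apply: iZn; rewrite doubleS ltnS.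
have st := trig_stein mZ (fun t => (tr t).1) (fun t => (tr t).2) iZZ
  (fun i l => iZn i (leqW l)).
set M := E (fun x => Z x ^+ k.+1.*2).
(* [1 - cos (2sz) = 2 sin^2 (sz)]: the two sides of the Stein identity at 2s and
   0 differ by O(s^2), so Fatou with [sin (sz) / s --> z] gives two more moments. *)
pose s n : R := n.+1%:R^-1.
pose f n x := Z x ^+ k.+1.*2 * (sin (s n * Z x) / s n) ^+ 2.
have s0 n : 0 < s n by rewrite invr_gt0 ltr0n.
have sin2 (y : R) : sin y ^+ 2 = 2^-1 * (1 - cos (2 * y)).
  by rewrite mulr_natl cos_mulr2n sin2cos2; field.
have fE n : f n = (fun x => (2^-1 / s n ^+ 2) *
   (Z x * Z x ^+ k.*2.+1 * cos (0 * Z x) - Z x * Z x ^+ k.*2.+1 * cos (2 * s n * Z x))).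
  apply/funext => x; rewrite /f expr_div_n sin2 mul0r cos0 -exprS -doubleS mulrA.
  by field; rewrite gt_eqF.
have mtZ t : measurable_fun setT (fun x => t * Z x) by exact: measurable_funM.
have iZc t : intg (fun x => Z x * Z x ^+ k.*2.+1 * cos (t * Z x)).
  by apply: intgMcos => //; exact: iZZ.
have if_ n : intg (f n) by rewrite fE; apply: intgZ; exact: intgB.
(* With [A], [B], [C] as below, the difference of the Stein identities at 0 and 2s is a((2k+1)(A -
   B) + 2sC). Since A - B is at most 2s^2 M and C at most 2sM, division by 2s^2 leaves a(2k + 1 +
   2)M, independent of s. *)
have Ef n : E (f n) <= a * (k.*2.+1%:R + 2) * M.
  rewrite fE expectZ ?expectB//; last exact: intgB.
  rewrite (st 0).1 (st (2 * s n)).1 /= mul0r subr0.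
  set A := E _; set B := E _; set C := E _.
  have AB : A - B <= 2 * s n ^+ 2 * M.
    have i1 : intg (fun x => Z x ^+ k.*2 * cos (0 * Z x)).
      by apply: intgMcos => //; apply: iZn; rewrite doubleS; lia.
    have i2 : intg (fun x => Z x ^+ k.*2 * cos (2 * s n * Z x)).
      by apply: intgMcos => //; apply: iZn; rewrite doubleS; lia.
    rewrite -expectB// -expectZ; last exact: ih.
    apply: expect_le => [||x]; [exact: intgB|exact: intgZ|].
    rewrite mul0r cos0 -mulrBr -mulrA.
    have -> : 1 - cos (2 * (s n * Z x)) = 2 * sin (s n * Z x) ^+ 2.
      by rewrite sin2; field.
    have := ler_abs_sin (s n * Z x); rewrite -(ler_sqr); rewrite ?nnegrE//.
    rewrite !real_normK ?num_real// exprMn => sl.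
    have -> : Z x ^+ k.+1.*2 = Z x ^+ k.*2 * Z x ^+ 2 by rewrite doubleS -addn2 exprD.
    rewrite [leRHS](_ : _ = Z x ^+ k.*2 * (2 * (s n ^+ 2 * Z x ^+ 2))); last by ring.
    apply: ler_wpM2l; first by rewrite -mul2n exprM exprn_ge0// sqr_ge0.
    exact: ler_wpM2l.
  have CM : C <= 2 * s n * M.
    rewrite -expectZ; last exact: ih.
    apply: expect_le => [||x].
    - by apply: intgMsin => //; apply: iZn; rewrite doubleS.
    - exact: intgZ.
    - rewrite (le_trans (ler_norm _))// normrM.
      apply: (le_trans (ler_wpM2l (normr_ge0 _) (ler_abs_sin _))).
      rewrite !normrM ger0_norm// [`|s n|]gtr0_norm// mulrCA -normrM -exprSr -doubleS.
      by rewrite -mul2n exprM ger0_norm// exprn_ge0// sqr_ge0.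
  have s2 : 0 < s n ^+ 2 by rewrite exprn_gt0.
  rewrite [leLHS](_ : _ = a * ((k.*2.+1%:R * (A - B) + 2 * s n * C) / (2 * s n ^+ 2))); last first.
    by field; rewrite gt_eqF.
  rewrite -[leRHS]mulrA ler_wpM2l// ler_pdivrMr ?mulr_gt0//.
  rewrite [leRHS](_ : _ = k.*2.+1%:R * (2 * s n ^+ 2 * M) + 2 * s n * (2 * s n * M)); last by ring.
  by rewrite lerD// ler_wpM2l// mulr_ge0// ltW.
have cvgf : {ae P, forall x, f n x @[n --> \oo] --> Z x ^+ k.+2.*2}.
  apply: aeW => x; rewrite doubleS -addn2 exprD.
  apply: cvgM; first exact: cvg_cst.
  by rewrite expr2; apply: cvgM; exact: cvg_sin_quotient.
have ev m x : 0 <= Z x ^+ m.*2.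
  by rewrite -mul2n exprM exprn_ge0// sqr_ge0.
have fC : \forall n \near \oo, E (f n) <= a * (k.*2.+1%:R + 2) * M by exact: nearW.
have [] := fatou_intg if_ _ _ _ cvgf fC => //.
  by move=> n x; rewrite mulr_ge0// sqr_ge0.
exact: measurable_funX.
Qed.

End moments.

(** * Hermite polynomials of Gaussian pairs *)

Section hermite_poly.
Context {R : realType}.

Fixpoint hermite_poly (n : nat) : {poly R} :=
  if n is m.+1 then 'X * hermite_poly m - (hermite_poly m)^`() else 1.

Lemma deriv_hermite_poly n :
  (hermite_poly n)^`() = n%:R *: hermite_poly n.-1.
Proof.
elim: n => [|n ih]; first by rewrite /= -polyC1 derivC scale0r.
rewrite -{1}[n.+1]/(n.+1) /= derivB derivM derivX mul1r ih derivZ.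
case: n ih => [|n] ih; first by rewrite !scale0r mulr0 subr0 addr0 scale1r.
rewrite -scalerAr -addrA -scalerBr -[in LHS]/(hermite_poly n.+1).
by rewrite -[in RHS]natr1 scalerDl scale1r addrC.
Qed.

Lemma hermiteE n (x : R) : hermite n x = (hermite_poly n).[x].
Proof.
pose g (y : R) := expR (- (y ^+ 2 / 2)).
have dg (y : R) : is_derive y 1 g (- y * g y).
  by apply: is_derive_eq; rewrite /g /GRing.scale/=; field.
suff h : derive1n n g = fun y => (-1) ^+ n * (hermite_poly n).[y] * g y.
  have -> : hermite n x = (-1) ^+ n * expR (x ^+ 2 / 2) * derive1n n g x by [].
  have e : expR (x ^+ 2 / 2) * g x = 1 by rewrite /g -expRD subrr expR0.
  rewrite h [LHS](_ : _ = ((-1) ^+ n) ^+ 2 * (expR (x ^+ 2 / 2) * g x) *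
    (hermite_poly n).[x]); last by ring.
  by rewrite e sqrr_sign !mul1r.
elim: n => [|n ih]; first by apply/funext => y /=; rewrite hornerC !mul1r.
rewrite derive1nS ih; apply/funext => y; rewrite derive1E.
have dp : is_derive y 1 (fun y => (hermite_poly n).[y]) (hermite_poly n)^`().[y].
  exact: is_derive_poly.
rewrite derive_val !(hornerE, exprS) /GRing.scale/=; ring.
Qed.

End hermite_poly.

Section poly_eq.
Context {R : numDomainType}.

Lemma poly_funP (p q : {poly R}) : (forall x, p.[x] = q.[x]) -> p = q.
Proof.
move=> pq; apply/eqP; rewrite -subr_eq0; apply/negPn/negP => pq0.
have := @max_poly_roots _ (p - q) [seq i%:R | i <- iota 0 (size (p - q))] pq0.
rewrite size_map size_iota ltnn => h; suff : false by [].
apply: h; first by apply/allP => x _; rewrite /root !hornerE pq subrr.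
by rewrite map_inj_uniq ?iota_uniq// => i j /eqP; rewrite eqr_nat => /eqP.
Qed.

Lemma horner_deriv_coef (p : {poly R}) x :
  p^`().[x] = \sum_(i < size p) p`_i * (i%:R * x ^+ i.-1).
Proof.
rewrite -{1}[p]coefK poly_def raddf_sum horner_sum; apply: eq_bigr => i _.
by rewrite /= derivZ derivXn hornerZ hornerMn hornerXn -mulr_natl.
Qed.

End poly_eq.

(** * Mixed moments of a Gaussian pair and orthogonality of Hermite polynomials *)

Section bigaussian.
Context {d} {T : measurableType d} {R : realType} (P : probability T R).
Local Notation E := (expect P).
Local Notation intg := (intg P).

Lemma gaussian_pair_swap (X Y : T -> R) b k a :
  gaussian_pair P X Y b k a -> gaussian_pair P Y X a k b.
Proof.
move=> g t u; have [gc gs] := g u t; split.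
  rewrite -[RHS](_ : expR (- ((u ^+ 2 * a + 2 * u * t * k + t ^+ 2 * b) / 2)) = _).
    by rewrite -gc; congr expect; apply/funext => x; rewrite addrC.
  by congr (expR (- (_ / 2))); ring.
by rewrite -gs; congr expect; apply/funext => x; rewrite addrC.
Qed.

(** Replacing [Y] by a combination of [X] and [Y] is what later turns a formula for powers of one
    variable into one for mixed monomials. *)
Lemma gaussian_pair_comb (X Y : T -> R) b k a (u v : R) :
  gaussian_pair P X Y b k a ->
  gaussian_pair P X (fun x => u * X x + v * Y x) b (u * b + v * k)
    (u ^+ 2 * b + 2 * u * v * k + v ^+ 2 * a).
Proof.
move=> g t w; have [gc gs] := g (t * v) (t * u + w).
have e x : t * (u * X x + v * Y x) + w * X x = t * v * Y x + (t * u + w) * X x.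
  by ring.
split; under eq_fun do rewrite e; rewrite ?gc//.
by congr (expR (- (_ / 2))); ring.
Qed.

Lemma gaussian_pair_diag (X Y : T -> R) b k a :
  gaussian_pair P X Y b k a -> gaussian_pair P X X b b b.
Proof.
move=> g; have := gaussian_pair_comb 1 0 g.
rewrite (_ : (fun x => _) = X); last first.
  by apply/funext => x; rewrite mul1r mul0r addr0.
by rewrite !mul1r mul0r addr0 expr1n expr0n/= mul1r mulr0 !mul0r !addr0.
Qed.

Section stein_poly.
Variables (X Y : T -> R) (r : R).
Hypotheses (mX : measurable_fun setT X) (mY : measurable_fun setT Y).
Hypotheses (iX2 : intg (fun x => X x ^+ 2)) (iY2 : intg (fun x => Y x ^+ 2)).
Hypothesis g : gaussian_pair P X Y 1 r 1.

Lemma intg_monomial (a b : nat) : intg (fun x => X x ^+ a * Y x ^+ b).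
Proof.
have iX := gaussian_moments mX iX2 ler01 (gaussian_pair_diag g).
have iY := gaussian_moments mY iY2 ler01 (gaussian_pair_diag (gaussian_pair_swap g)).
apply: intg_le (intgD (iX a.*2) (iY b.*2)) _.
  by apply: measurable_funM; exact: measurable_funX.
move=> x; rewrite -!muln2 !exprM; set p := X x ^+ a; set q := Y x ^+ b.
rewrite normrM -[p ^+ 2]real_normK ?num_real// -[q ^+ 2]real_normK ?num_real//.
by have := sqr_ge0 (`|p| - `|q|); have := normr_ge0 p; have := normr_ge0 q; nra.
Qed.

Let M a b := E (fun x => X x ^+ a * Y x ^+ b).

Lemma intg_comb_pow (t : R) (c n : nat) :
  intg (fun x => X x ^+ c * (t * X x + 1 * Y x) ^+ n).
Proof.
have e x : X x ^+ c * (t * X x + 1 * Y x) ^+ n =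
  \sum_(i < n.+1) ('C(n, i)%:R * t ^+ i) * (X x ^+ (c + i) * Y x ^+ (n - i)).
  rewrite addrC exprDn mulr_sumr; apply: eq_bigr => i _.
  by rewrite mul1r exprMn exprD -mulr_natl; ring.
under eq_fun do rewrite e.
by apply: intg_sum => i _; apply: intgZ; exact: intg_monomial.
Qed.

Lemma expect_comb_pow (t : R) (c n : nat) :
  E (fun x => X x ^+ c * (t * X x + 1 * Y x) ^+ n) =
  \sum_(i < n.+1) ('C(n, i)%:R * M (c + i) (n - i)) * t ^+ i.
Proof.
have e x : X x ^+ c * (t * X x + 1 * Y x) ^+ n =
  \sum_(i < n.+1) ('C(n, i)%:R * t ^+ i) * (X x ^+ (c + i) * Y x ^+ (n - i)).
  rewrite addrC exprDn mulr_sumr; apply: eq_bigr => i _.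
  by rewrite mul1r exprMn exprD -mulr_natl; ring.
under eq_fun do rewrite e.
rewrite expect_sum; last by move=> i _; apply: intgZ; exact: intg_monomial.
apply: eq_bigr => i _; rewrite expectZ; last exact: intg_monomial.
by rewrite mulrAC.
Qed.

(** Integration by parts at frequency 0, where the cosine is 1 and the sine term vanishes, applied
    to [Z = t X + Y]; the covariance of [X] and [Z] is [t + r]. *)
Lemma stein_comb (t : R) (n : nat) :
  E (fun x => X x ^+ 1 * (t * X x + 1 * Y x) ^+ n) =
  (t + r) * (n%:R * E (fun x => X x ^+ 0 * (t * X x + 1 * Y x) ^+ n.-1)).
Proof.
have gZ := gaussian_pair_comb t 1 g; rewrite mulr1 mul1r in gZ.
have mZ : measurable_fun setT (fun x => t * X x + 1 * Y x).
  by apply: measurable_funD; exact: measurable_funM.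
have iX : intg X by have := @intg_exp_le _ _ _ P X 1 1 mX iX2 isT.
have tr := gaussian_pair_trig iX mZ gZ.
have iXZ i : (i <= n)%N -> intg (fun x => X x * (t * X x + 1 * Y x) ^+ i).
  by move=> _; exact: (intg_comb_pow t 1 i).
have iZ i : (i <= n)%N -> intg (fun x => (t * X x + 1 * Y x) ^+ i).
  move=> _; have h := intg_comb_pow t 0 i.
  rewrite (_ : (fun x => _) = fun x => X x ^+ 0 * (t * X x + 1 * Y x) ^+ i) //.
  by apply/funext => x; rewrite expr0 !mul1r.
have [st _] := @trig_stein _ _ _ _ X _ _ mZ (fun t => (tr t).1) (fun t => (tr t).2) n iXZ iZ 0.
move: st; rewrite mul0r subr0 => st.
have z (F : T -> R) : (fun x => F x * cos (0 * (t * X x + 1 * Y x))) = F.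
  by apply/funext => x; rewrite mul0r cos0 mulr1.
rewrite !z in st; apply: etrans st _; congr (_ * (_ * E _)).
by apply/funext => x; rewrite expr0 !mul1r.
Qed.

(** Both sides of [stein_comb] are polynomials in [t], so their coefficients agree; the coefficient
    of t^a in degree n = a + b isolates the mixed moment with exponents a + 1 and b. *)
Lemma stein_monomial a b :
  M a.+1 b = a%:R * M a.-1 b + r * (b%:R * M a b.-1).
Proof.
pose n := (a + b)%N.
(* [p] and [('X + r%:P) * q] are the two sides as polynomials in [t]; the range [i < n] makes
   [q = 0] when [n = 0], where [n.-1] would be misleading. *)
pose p := \poly_(i < n.+1) ('C(n, i)%:R * M (1 + i) (n - i)).
pose q := \poly_(i < n) (n%:R * ('C(n.-1, i)%:R * M (0 + i) (n.-1 - i))).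
have pq : p = ('X + r%:P) * q.
  apply: poly_funP => t; rewrite !hornerE !horner_poly -expect_comb_pow stein_comb.
  case: n @p @q => [|n] p q; first by rewrite mul0r big_ord0.
  congr (_ * _); rewrite expect_comb_pow mulr_sumr.
  by apply: eq_bigr => i _; rewrite mulrA.
have := congr1 (fun p : {poly R} => p`_a) pq.
rewrite mulrDl coefD coefXM coefCM !coef_poly ltnS leq_addr /=.
have Cgt0 : ('C(n, a)%:R : R) != 0 by rewrite pnatr_eq0 -lt0n bin_gt0 leq_addr.
rewrite (_ : (n - a)%N = b) ?add1n; last by rewrite /n addKn.
move=> h; apply: (mulfI Cgt0); rewrite h mulrDr.
clear h Cgt0 p q pq; rewrite {}/n; congr (_ + _); last first.
  case: b => [|b]; first by rewrite addn0 ltnn mul0r !mulr0.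
  rewrite addnS ltnS leq_addr /= add0n addKn.
  have e : (a + b).+1%:R * 'C(a + b, a)%:R = 'C((a + b).+1, a)%:R * b.+1%:R :> R.
    rewrite -!natrM; congr _%:R.
    by have := mul_bin_down (a + b).+1 a; rewrite /=; lia.
  rewrite [RHS](_ : _ = r * ('C((a + b).+1, a)%:R * b.+1%:R * M a b)); last by ring.
  by rewrite -e; ring.
case: a => [|a] /=; first by rewrite mul0r mulr0.
rewrite addSn /= ltnS leq_addr add0n addKn mulrA.
have e : (a + b).+1%:R * 'C(a + b, a)%:R = 'C((a + b).+1, a.+1)%:R * a.+1%:R :> R.
  rewrite -!natrM; congr _%:R.
  by have := mul_bin_diag (a + b).+1 a; rewrite /=; lia.
by rewrite e mulrA.
Qed.

Lemma horner2_sum (p q : {poly R}) x y :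
  p.[x] * q.[y] = \sum_(i < size p) \sum_(j < size q) p`_i * q`_j * (x ^+ i * y ^+ j).
Proof.
rewrite !horner_coef mulr_suml; apply: eq_bigr => i _; rewrite mulr_sumr.
by apply: eq_bigr => j _; ring.
Qed.

Lemma intg_monomial_sum (m n : nat) (c : nat -> nat -> R) (k l : nat -> nat) :
  intg (fun x => \sum_(i < m) \sum_(j < n) c i j * (X x ^+ k i * Y x ^+ l j)).
Proof.
by apply: intg_sum => i _; apply: intg_sum => j _; apply: intgZ; exact: intg_monomial.
Qed.

Lemma expect_monomial_sum (m n : nat) (c : nat -> nat -> R) (k l : nat -> nat) :
  E (fun x => \sum_(i < m) \sum_(j < n) c i j * (X x ^+ k i * Y x ^+ l j)) =
  \sum_(i < m) \sum_(j < n) c i j * M (k i) (l j).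
Proof.
have im i j : intg (fun x => c i j * (X x ^+ k i * Y x ^+ l j)).
  by apply: intgZ; exact: intg_monomial.
rewrite expect_sum => [|i _]; last exact: intg_sum.
apply: eq_bigr => i _; rewrite expect_sum => [|j _]; last exact: im.
by apply: eq_bigr => j _; rewrite expectZ//; exact: intg_monomial.
Qed.

Lemma intg_horner2 (p q : {poly R}) : intg (fun x => p.[X x] * q.[Y x]).
Proof.
under eq_fun do rewrite horner2_sum.
exact: (intg_monomial_sum _ _ (fun i j => p`_i * q`_j) id id).
Qed.

Lemma stein_poly (p q : {poly R}) :
  E (fun x => X x * p.[X x] * q.[Y x]) =
  E (fun x => p^`().[X x] * q.[Y x]) + r * E (fun x => p.[X x] * q^`().[Y x]).
Proof.
have -> : (fun x => X x * p.[X x] * q.[Y x]) = (fun x => \sum_(i < size p)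
    \sum_(j < size q) p`_i * q`_j * (X x ^+ i.+1 * Y x ^+ j)).
  apply/funext => x; rewrite -mulrA horner2_sum mulr_sumr; apply: eq_bigr => i _.
  by rewrite mulr_sumr; apply: eq_bigr => j _; rewrite exprS; ring.
have -> : (fun x => p^`().[X x] * q.[Y x]) = (fun x => \sum_(i < size p)
    \sum_(j < size q) p`_i * q`_j * i%:R * (X x ^+ i.-1 * Y x ^+ j)).
  apply/funext => x; rewrite horner_deriv_coef horner_coef mulr_suml.
  by apply: eq_bigr => i _; rewrite mulr_sumr; apply: eq_bigr => j _; ring.
have -> : (fun x => p.[X x] * q^`().[Y x]) = (fun x => \sum_(i < size p)
    \sum_(j < size q) p`_i * q`_j * j%:R * (X x ^+ i * Y x ^+ j.-1)).
  apply/funext => x; rewrite horner_deriv_coef horner_coef mulr_suml.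
  by apply: eq_bigr => i _; rewrite mulr_sumr; apply: eq_bigr => j _; ring.
rewrite (expect_monomial_sum _ _ (fun i j => p`_i * q`_j) S id).
rewrite (expect_monomial_sum _ _ (fun i j => p`_i * q`_j * i%:R) predn id).
rewrite (expect_monomial_sum _ _ (fun i j => p`_i * q`_j * j%:R) id predn).
rewrite mulr_sumr -big_split; apply: eq_bigr => i _ /=.
rewrite mulr_sumr -big_split; apply: eq_bigr => j _ /=.
by rewrite stein_monomial; ring.
Qed.

End stein_poly.

(** Integration by parts against the constant polynomial 1 equates E[X H_n(X)] with E[H_n'(X)],
    which is exactly the cancellation in the recurrence for H_(n+1). This is the base case of the
    next lemma. *)
Lemma expect_hermite_poly (X Y : T -> R) (r : R) (n : nat) :
  measurable_fun setT X -> measurable_fun setT Y ->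
  intg (fun x => X x ^+ 2) -> intg (fun x => Y x ^+ 2) ->
  gaussian_pair P X Y 1 r 1 ->
  E (fun x => (hermite_poly n).[X x]) = (n == 0%N)%:R.
Proof.
move=> mX mY iX iY g; case: n => [|n].
  by under eq_fun do rewrite hornerC; rewrite expect_cst.
pose p : {poly R} := hermite_poly n.
have one (f : T -> R) : (fun x => f x * (1 : {poly R}).[Y x]) = f.
  by apply/funext => x; rewrite hornerC mulr1.
have st := stein_poly mX mY iX iY g p 1.
have d0 : (fun x => p.[X x] * (1 : {poly R})^`().[Y x]) = fun=> 0.
  by apply/funext => x; rewrite -polyC1 derivC horner0 mulr0.
rewrite d0 expect_cst mulr0 addr0 !one in st.
have i1 : intg (fun x => X x * p.[X x]).
  have := intg_horner2 mX mY iX iY g ('X * p) 1; rewrite one.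
  by under eq_fun do rewrite hornerM hornerX.
have i2 : intg (fun x => p^`().[X x]).
  by have := intg_horner2 mX mY iX iY g p^`() 1; rewrite one.
rewrite (_ : (fun x => _) = (fun x => X x * p.[X x] - p^`().[X x])).
  by rewrite expectB// st subrr.
by apply/funext => x; rewrite /= !hornerE.
Qed.

(** In E[(X H_n - H_n')(X) H_m(Y)] the derivative of H_n cancels, leaving r E[H_n(X) H_m'(Y)] with
    H_m' = m H_(m-1): both indices drop by one and a factor r m appears. *)
Lemma expect_hermite_poly2 (X Y : T -> R) (r : R) (n m : nat) :
  measurable_fun setT X -> measurable_fun setT Y ->
  intg (fun x => X x ^+ 2) -> intg (fun x => Y x ^+ 2) ->
  gaussian_pair P X Y 1 r 1 ->
  E (fun x => (hermite_poly n).[X x] * (hermite_poly m).[Y x]) =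
    (n == m)%:R * (n`!%:R * r ^+ n).
Proof.
move=> mX mY iX iY g; elim: n m => [|n ih] m.
  under eq_fun do rewrite hornerC mul1r.
  rewrite (expect_hermite_poly m mY mX iY iX (gaussian_pair_swap g)).
  by rewrite eq_sym mulr1 mulr1.
pose p : {poly R} := hermite_poly n; pose q : {poly R} := hermite_poly m.
have st := stein_poly mX mY iX iY g p q.
have i1 : intg (fun x => X x * p.[X x] * q.[Y x]).
  have := intg_horner2 mX mY iX iY g ('X * p) q.
  by under eq_fun do rewrite hornerM hornerX.
have i2 := intg_horner2 mX mY iX iY g p^`() q.
rewrite (_ : (fun x => _) = (fun x => X x * p.[X x] * q.[Y x] - p^`().[X x] * q.[Y x])); last first.
  by apply/funext => x; rewrite -mulrBl /= !hornerE.
rewrite expectB// st addrAC subrr add0r.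
rewrite (_ : (fun x => _) = (fun x => m%:R * (p.[X x] * (hermite_poly m.-1).[Y x]))); last first.
  by apply/funext => x; rewrite /q deriv_hermite_poly hornerZ mulrCA.
rewrite expectZ ?ih; last exact: intg_horner2.
case: m @q st i1 i2 => [|m] q st i1 i2 /=; first by rewrite !mul0r mulr0.
rewrite eqSS; have [<-|_] := eqVneq n m; last by rewrite !mul0r !mulr0.
by rewrite !mul1r exprS factS natrM; ring.
Qed.

End bigaussian.

(** * Square-integrable functions *)

Section square_integrable.
Context {d} {T : measurableType d} {R : realType} (P : probability T R).
Implicit Types f g : T -> R.
Local Notation E := (expect P).
Local Notation intg := (intg P).

(** Membership in L^2 phrased with real expectations, so that norms can be handled by ring
    arithmetic; [Lfun2P] and [L2_cvgP] translate back to the extended-real norm. *)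
Definition sqintg f := measurable_fun setT f /\ intg (fun x => f x ^+ 2).

Lemma Lnorm2_integral f :
  Lnorm P 2%:E (EFin \o f) = ((\int[P]_x (f x ^+ 2)%:E) `^ 2^-1)%E.
Proof.
rewrite unlock; congr (_ `^ _)%E; apply: eq_integral => x _ /=.
by rewrite powR_mulrn// real_normK ?num_real.
Qed.

Lemma Lfun2P f : f \in Lfun P 2%:E <-> sqintg f.
Proof.
split.
  move=> fL; split; first exact: (set_mem (sub_Lfun_mfun fL)).
  exact: Lfun2_integrable_sqr.
move=> [mf if2]; rewrite inE; apply/andP; split; first by rewrite inE.
rewrite inE /= /finite_norm Lnorm2_integral -EFin_expect//.
by rewrite poweR_EFin ltry.
Qed.

Lemma Lnorm2E f : sqintg f -> Lnorm P 2%:E (EFin \o f) = (Num.sqrt (E (fun x => f x ^+ 2)))%:E.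
Proof.
move=> [mf if2]; rewrite Lnorm2_integral -EFin_expect// poweR_EFin powR12_sqrt//.
by apply: expect_ge0 => x; exact: sqr_ge0.
Qed.

Lemma sqintgM f g : sqintg f -> sqintg g -> intg (fun x => f x * g x).
Proof.
move=> [mf f2] [mg g2]; apply: intg_le (intgD f2 g2) _; first exact: measurable_funM.
move=> x; rewrite normrM -[f x ^+ 2]real_normK ?num_real// -[g x ^+ 2]real_normK ?num_real//.
by have := sqr_ge0 (`|f x| - `|g x|); have := normr_ge0 (f x); have := normr_ge0 (g x); nra.
Qed.

Lemma sqintg_cst c : sqintg (fun=> c).
Proof. by split; [exact: measurable_cst|exact: intg_cst]. Qed.

Lemma sqintg_intg f : sqintg f -> intg f.
Proof.
move=> /(sqintgM)/(_ (sqintg_cst 1)).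
by under eq_fun do rewrite mulr1.
Qed.

Lemma sqintgD f g : sqintg f -> sqintg g -> sqintg (fun x => f x + g x).
Proof.
move=> sf sg; split.
  by apply: measurable_funD; [exact: sf.1|exact: sg.1].
under eq_fun do rewrite sqrrD.
apply: intgD; last exact: sg.2.
by apply: intgD; [exact: sf.2|apply: intgD; exact: sqintgM].
Qed.

Lemma sqintgZ c f : sqintg f -> sqintg (fun x => c * f x).
Proof.
move=> [mf f2]; split; first exact: measurable_funM.
by under eq_fun do rewrite exprMn; exact: intgZ.
Qed.

Lemma sqintgB f g : sqintg f -> sqintg g -> sqintg (fun x => f x - g x).
Proof.
move=> sf sg; under eq_fun do rewrite -mulN1r.
by apply: sqintgD => //; exact: sqintgZ.
Qed.

Lemma sqintg_sum (I : Type) (s : seq I) (Q : pred I) (F : I -> T -> R) :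
  (forall i, Q i -> sqintg (F i)) -> sqintg (fun x => \sum_(i <- s | Q i) F i x).
Proof.
move=> iF; elim: s => [|i s ih].
  rewrite (_ : (fun _ => _) = fun=> 0); first exact: sqintg_cst.
  by apply/funext => x; rewrite big_nil.
case Qi: (Q i); last by under eq_fun do rewrite big_cons Qi.
by under eq_fun do rewrite big_cons Qi; apply: sqintgD => //; exact: iF.
Qed.

Lemma sqr_expect_le f : sqintg f -> E f ^+ 2 <= E (fun x => f x ^+ 2).
Proof.
move=> sf; have ifn := sqintg_intg sf.
have := @expect_ge0 _ _ _ P (fun x => (f x - E f) ^+ 2) (fun x => sqr_ge0 _).
have e x : (f x - E f) ^+ 2 = f x ^+ 2 - 2 * E f * f x + E f ^+ 2 by ring.
under eq_fun do rewrite e.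
have i1 : intg (fun x => 2 * E f * f x) by exact: intgZ.
have i2 := intgB sf.2 i1.
rewrite (expectD i2 (intg_cst _ _)) (expectB sf.2 i1) (expectZ _ ifn) expect_cst.
by nra.
Qed.

Lemma norm_expect_le f : intg f -> `|E f| <= E (fun x => `|f x|).
Proof. by move=> i; exact: le_normr_Rintegral. Qed.

Lemma expect_norm_le f : sqintg f -> E (fun x => `|f x|) <= Num.sqrt (E (fun x => f x ^+ 2)).
Proof.
move=> sf; have sn : sqintg (fun x => `|f x|).
  split; first by apply: measurableT_comp; [exact: normr_measurable|exact: sf.1].
  by under eq_fun do rewrite real_normK ?num_real//; exact: sf.2.
rewrite -(ler_sqr); rewrite ?nnegrE ?sqrtr_ge0//; last by apply: expect_ge0.
rewrite sqr_sqrtr; last by apply: expect_ge0 => x; exact: sqr_ge0.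
apply: (le_trans (sqr_expect_le sn)).
by under eq_fun do rewrite real_normK ?num_real//.
Qed.

Lemma L2_cvgP (F : nat -> T -> R) f : (forall n, sqintg (F n)) -> sqintg f ->
  L2_cvg P F f <-> E (fun x => (F n x - f x) ^+ 2) @[n --> \oo] --> 0.
Proof.
move=> sF sf; have sB n := sqintgB (sF n) sf.
have e0 n : 0 <= E (fun x => (F n x - f x) ^+ 2).
  by apply: expect_ge0 => x; exact: sqr_ge0.
have LE : (fun n => Lnorm P 2%:E (EFin \o (fun x => F n x - f x))) =
  (fun n => (Num.sqrt (E (fun x => (F n x - f x) ^+ 2)))%:E).
  by apply/funext => n; rewrite Lnorm2E.
rewrite /L2_cvg LE; split => h.
  have h1 : Num.sqrt (E (fun x => (F n x - f x) ^+ 2)) @[n --> \oo] --> (0 : R).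
    exact: (fine_cvg h).
  have h2 : Num.sqrt (E (fun x => (F n x - f x) ^+ 2)) *
    Num.sqrt (E (fun x => (F n x - f x) ^+ 2)) @[n --> \oo] --> (0 * 0 : R) by exact: cvgM.
  rewrite mulr0 in h2.
  have eqs n : Num.sqrt (E (fun x => (F n x - f x) ^+ 2))
    * Num.sqrt (E (fun x => (F n x - f x) ^+ 2)) = E (fun x => (F n x - f x) ^+ 2).
    by rewrite -expr2 sqr_sqrtr.
  by rewrite (funext eqs) in h2.
apply: cvg_EFin; first exact: nearW.
rewrite -[X in _ --> X]sqrtr0.
apply: (cvg_comp _ _ h); exact: sqrt_continuous.
Qed.

Lemma ae_eq_expect f g : measurable_fun setT f -> measurable_fun setT g ->
  f = g %[ae P] -> E f = E g.
Proof.
move=> mf mg fg; rewrite /expect /Rintegral; congr fine.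
apply: ae_eq_integral => //; [exact/measurable_EFinP..|].
by apply: filterS fg => x /= -> .
Qed.

End square_integrable.

(** * Gaussian variables on an abstract Wiener space *)

Section inner_product.
Context {R : realType} {H : completeNormedModType R} (ip : {dot H for idfun}).

Lemma ipC u v : ip u v = ip v u.
Proof. by rewrite hermC expr0 mul1r. Qed.

Lemma ipDr u v w : ip u (v + w) = ip u v + ip u w.
Proof. exact: linearDr. Qed.

Lemma ipZr a u v : ip u (a *: v) = a * ip u v.
Proof. by rewrite linearZr_LR. Qed.

Lemma ip0r u : ip u 0 = 0.
Proof. exact: linear0r. Qed.

Lemma ip_sumr (I : Type) (s : seq I) (Q : pred I) (F : I -> H) u :
  ip u (\sum_(i <- s | Q i) F i) = \sum_(i <- s | Q i) ip u (F i).
Proof. exact: linear_sumr. Qed.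

Lemma ipDl u v w : ip (u + v) w = ip u w + ip v w.
Proof. by rewrite ipC ipDr ipC [ip w v]ipC. Qed.

Lemma ipZl a u v : ip (a *: u) v = a * ip u v.
Proof. by rewrite ipC ipZr ipC. Qed.

Lemma ip_suml (I : Type) (s : seq I) (Q : pred I) (F : I -> H) u :
  ip (\sum_(i <- s | Q i) F i) u = \sum_(i <- s | Q i) ip (F i) u.
Proof. by rewrite ipC ip_sumr; apply: eq_bigr => i _; rewrite ipC. Qed.

Lemma ipBl u v w : ip (u - v) w = ip u w - ip v w.
Proof. by rewrite ipDl -scaleN1r ipZl mulN1r. Qed.

Lemma ipBr u v w : ip u (v - w) = ip u v - ip u w.
Proof. by rewrite ipC ipBl ipC [ip w u]ipC. Qed.

Lemma ip_gt0 u : u != 0 -> 0 < ip u u.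
Proof. exact: neq0_dnorm_gt0. Qed.

Lemma ip_ge0 u : 0 <= ip u u.
Proof. by have [->|/ip_gt0/ltW//] := eqVneq u 0; rewrite ip0r. Qed.

Lemma ip_nondeg u v : (forall w, ip u w = ip v w) -> u = v.
Proof.
move=> uv; apply/eqP; rewrite -subr_eq0; apply/negPn/negP => /ip_gt0.
by rewrite ipBl uv subrr ltxx.
Qed.

End inner_product.

Section dual_comb.
Context {R : realType} {B : normedModType R}.
Variables (t u : R) (l m : dual B).

(** The characteristic functional at a combination of two functionals is their joint characteristic
    function; hence the dual must be closed under combinations. *)
Definition dual_comb_fun (x : B) : R := t * l x + u * m x.

Lemma dual_comb_linear : linear_for *%R dual_comb_fun.
Proof. by move=> a x y; rewrite /dual_comb_fun !linearP /=; ring. Qed.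

HB.instance Definition _ := GRing.isLinear.Build R B R *%R dual_comb_fun dual_comb_linear.

Lemma dual_comb_continuous : continuous (dual_comb_fun : B -> R).
Proof.
move=> x; apply: cvgD; apply: cvgM; try exact: cvg_cst; exact: dual_continuous.
Qed.

Definition dual_comb : dual B := @Dual R B dual_comb_fun dual_comb_continuous.

End dual_comb.

Lemma dense_seq {R : realType} (H : normedModType R) (I : Type) (f : I -> H) :
  dense (range f) -> forall h : H, exists l : nat -> I, f (l k) @[k --> \oo] --> h.
Proof.
move=> df h.
have ex k : exists i, `|h - f i| < k.+1%:R^-1 :> R.
  have k0 : 0 < k.+1%:R^-1 :> R by rewrite invr_gt0 ltr0n.
  have [|y [hy [i _ fi]]] := df (ball h k.+1%:R^-1) _ (ball_open _ _).
    by exists h; exact: ballxx.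
  by exists i; rewrite fi; move: hy; rewrite -ball_normE.
have [l hl] := choice ex; exists l.
apply/cvgrPdist_lt => e e0.
have /cvgr0_norm_lt/(_ e e0) := @cvg_harmonic R; apply: filterS => k.
rewrite /= ger0_norm; last by rewrite invr_ge0 ler0n.
exact: lt_trans (hl k).
Qed.

Section wiener.
Context {R : realType} (W : abstract_wiener_space R).
Local Notation H := (aws_H W).
Local Notation B := (borel (aws_B W)).
Local Notation mu := (aws_mu W).
Local Notation ip := (aws_ip W).
Local Notation E := (expect mu).
Local Notation intg := (intg mu).
Local Notation sqintg := (sqintg mu).

Lemma dual_measurable (l : dual (aws_B W)) : measurable_fun setT (l : B -> R).
Proof.
apply: (measurability _ (RGenOInfty.measurableE R)) => _ [_ [a ->] <-].
rewrite setTI; apply: sub_sigma_algebra.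
apply: open_comp; last by rewrite set_itvE; exact: open_gt.
by move=> x _; exact: dual_continuous.
Qed.

Lemma aws_dual_comb t u (l m : dual (aws_B W)) :
  aws_dual (dual_comb t u l m) = t *: aws_dual l + u *: aws_dual m.
Proof.
apply: (@ip_nondeg _ _ ip) => h.
by rewrite aws_dualE ipDl !ipZl !aws_dualE.
Qed.

Variable tilde : H -> B -> R.
Hypothesis Htilde : gaussian_extension tilde.

Lemma tilde_sqintg h : sqintg (tilde h).
Proof. by apply/Lfun2P; exact: tilde_L2. Qed.

(** The characteristic functional does not give integrability directly. The constant sequence [l]
    converges to [tilde (aws_dual l)], so the difference has L^2 norm 0 and [l] inherits square
    integrability. *)
Lemma dual_sqintg (l : dual (aws_B W)) : sqintg (l : B -> R).
Proof.
have h : L2_cvg mu (fun _ : nat => l : B -> R) (tilde (aws_dual l)).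
  by apply: (tilde_cvg Htilde (l_ := fun=> l)); exact: cvg_cst.
rewrite /L2_cvg in h.
have N0 : Lnorm mu 2%:E (EFin \o (fun x => l x - tilde (aws_dual l) x)) = 0%E.
  by apply: cvg_unique h; first exact: ereal_hausdorff; exact: cvg_cst.
have sd : sqintg (fun x => l x - tilde (aws_dual l) x).
  apply/Lfun2P; rewrite inE; apply/andP; split; rewrite inE /=.
    by apply: measurable_funB; [exact: dual_measurable|exact: (tilde_sqintg _).1].
  by rewrite /finite_norm N0.
have := sqintgD sd (tilde_sqintg (aws_dual l)).
by under eq_fun do rewrite subrK.
Qed.

(** Boundedness of [f] gives integrability; the Lipschitz bound controls the difference of
    expectations by L^1 distances, which are at most the L^2 distances. *)
Lemma expect_lipschitz_cvg (f : R -> R) (l m : nat -> dual (aws_B W)) (h k : H) (t u : R) :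
  (forall x y, `|f x - f y| <= `|x - y|) -> measurable_fun setT f ->
  (forall x, `|f x| <= 1) ->
  aws_dual (l j) @[j --> \oo] --> h -> aws_dual (m j) @[j --> \oo] --> k ->
  E (fun x => f (t * l j x + u * m j x)) @[j --> \oo] -->
    E (fun x => f (t * tilde h x + u * tilde k x)).
Proof.
move=> lip mf f1 lh mk.
have /L2_cvgP lL : L2_cvg mu (fun j x => l j x) (tilde h) by exact: tilde_cvg.
have /L2_cvgP mL : L2_cvg mu (fun j x => m j x) (tilde k) by exact: tilde_cvg.
have {}lL := lL (fun=> dual_sqintg _) (tilde_sqintg _).
have {}mL := mL (fun=> dual_sqintg _) (tilde_sqintg _).
pose b j := `|t| * Num.sqrt (E (fun x => (l j x - tilde h x) ^+ 2)) +
            `|u| * Num.sqrt (E (fun x => (m j x - tilde k x) ^+ 2)).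
have b0 : b j @[j --> \oo] --> (0 : R).
  rewrite (_ : 0 = `|t| * Num.sqrt 0 + `|u| * Num.sqrt 0 :> R); last first.
    by rewrite sqrtr0 !mulr0 addr0.
  apply: cvgD; apply: cvgM; try exact: cvg_cst.
    by apply: (cvg_comp _ _ lL); exact: sqrt_continuous.
  by apply: (cvg_comp _ _ mL); exact: sqrt_continuous.
have intf (g : B -> R) : measurable_fun setT g -> intg (fun x => f (g x)).
  move=> mg; apply: intg_le (intg_cst mu 1) _; last by [].
  exact: measurableT_comp.
have bd j : `|E (fun x => f (t * tilde h x + u * tilde k x)) -
   E (fun x => f (t * l j x + u * m j x))| <= b j.
  have st := sqintgD (sqintgZ t (tilde_sqintg h)) (sqintgZ u (tilde_sqintg k)).
  have sl := sqintgD (sqintgZ t (dual_sqintg (l j))) (sqintgZ u (dual_sqintg (m j))).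
  have i1 := intf _ st.1; have i2 := intf _ sl.1.
  rewrite -expectB//.
  have dl := sqintgB (dual_sqintg (l j)) (tilde_sqintg h).
  have dm := sqintgB (dual_sqintg (m j)) (tilde_sqintg k).
  apply: (le_trans (norm_expect_le (intgB i1 i2))).
  apply: (@le_trans _ _ (E (fun x => `|t| * `|l j x - tilde h x| + `|u| * `|m j x - tilde k x|))).
    apply: expect_le => [||x].
    - exact: intg_norm (intgB i1 i2).
    - by apply: intgD; apply: intgZ; apply: intg_norm; exact: sqintg_intg.
    - apply: (le_trans (lip _ _)); rewrite distrC -!normrM.
      rewrite (_ : _ - _ = t * (l j x - tilde h x) + u * (m j x - tilde k x)); last by ring.
      exact: ler_normD.
  rewrite expectD ?expectZ //; try (apply: intgZ); try (apply: intg_norm; exact: sqintg_intg).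
  by apply: lerD; apply: ler_wpM2l => //; exact: expect_norm_le.
apply/cvgrPdist_lt => e e0.
have /cvgr0_norm_lt/(_ e e0) := b0; apply: filterS => j bj.
by apply: le_lt_trans (bd j) _; apply: le_lt_trans bj; exact: ler_norm.
Qed.

(** For functionals the formula is the characteristic functional at a combination; by density both
    sides pass to the limit, the left one because cosine and sine are bounded and Lipschitz. *)
Lemma tilde_gaussian_pair h k :
  gaussian_pair mu (tilde h) (tilde k) (ip h h) (ip h k) (ip k k).
Proof.
move=> t u.
have [l lk] := dense_seq (@aws_dual_dense R W) k.
have [m mh] := dense_seq (@aws_dual_dense R W) h.
have Ej j := aws_mu_cos (dual_comb t u (l j) (m j)).
have Sj j := aws_mu_sin (dual_comb t u (l j) (m j)).
have cont_m (f : R -> R) : continuous f -> measurable_fun setT f.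
  by exact: continuous_measurable_fun.
have cosc := @expect_lipschitz_cvg cos l m k h t u (@cos_lipschitz R)
  (cont_m _ (@continuous_cos R)) (@cos_max R) lk mh.
have sinc := @expect_lipschitz_cvg sin l m k h t u (@sin_lipschitz R)
  (cont_m _ (@continuous_sin R)) (@sin_max R) lk mh.
have Ec j : E (fun x => cos (t * l j x + u * m j x)) =
  expR (- (`|t *: aws_dual (l j) + u *: aws_dual (m j)| ^+ 2 / 2)).
  have := Ej j; rewrite unlock aws_dual_comb => h1.
  by rewrite /expect /Rintegral h1.
have Es j : E (fun x => sin (t * l j x + u * m j x)) = 0.
  by have := Sj j; rewrite unlock => h1; rewrite /expect /Rintegral h1.
rewrite (funext Ec) in cosc; rewrite (funext Es) in sinc.
split; last exact: (cvg_unique _ sinc (cvg_cst _)).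
apply: (cvg_unique _ cosc) => //.
rewrite (_ : _ / 2 = `|t *: k + u *: h| ^+ 2 / 2); last first.
  rewrite -aws_ip_norm ipDl !ipDr !ipZl !ipZr [ip k h]ipC; ring.
have nrm : `|t *: aws_dual (l j) + u *: aws_dual (m j)| @[j --> \oo] --> `|t *: k + u *: h|.
  by apply: cvg_norm; apply: cvgD; apply: cvgZ => //; exact: cvg_cst.
have nrm2 : - (`|t *: aws_dual (l j) + u *: aws_dual (m j)| ^+ 2 / 2)
    @[j --> \oo] --> - (`|t *: k + u *: h| ^+ 2 / 2).
  apply: cvgN; apply: cvgM; last exact: cvg_cst.
  by rewrite expr2; apply: cvgM.
by apply: (cvg_comp _ _ nrm2); exact: continuous_expR.
Qed.

(** The normalized variables have covariance <h, k>/(|h||k|), and the prefactors |h|^n and |k|^n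
    restore <h, k>^n. *)
Lemma expect_hermite (h k : H) n m : h != 0 -> k != 0 ->
  E (fun x => `|h| ^+ n * hermite n (tilde h x / `|h|) *
              (`|k| ^+ m * hermite m (tilde k x / `|k|))) =
  (n == m)%:R * (n`!%:R * ip h k ^+ n).
Proof.
move=> h0 k0; have nh : `|h| != 0 by rewrite normr_eq0.
have nk : `|k| != 0 by rewrite normr_eq0.
pose X x := tilde h x / `|h|; pose Y x := tilde k x / `|k|.
have [mh h2] := tilde_sqintg h; have [mk k2] := tilde_sqintg k.
have [mX X2] : sqintg X.
  by rewrite /X; under eq_fun do rewrite mulrC; exact: sqintgZ.
have [mY Y2] : sqintg Y.
  by rewrite /Y; under eq_fun do rewrite mulrC; exact: sqintgZ.
have g : gaussian_pair mu X Y 1 (ip h k / (`|h| * `|k|)) 1.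
  move=> t u; have [gc gs] := tilde_gaussian_pair h k (t / `|k|) (u / `|h|).
  have e x : t * Y x + u * X x = t / `|k| * tilde k x + u / `|h| * tilde h x.
    by rewrite /X /Y; ring.
  split; under eq_fun do rewrite e; rewrite ?gc ?gs//.
  by rewrite !aws_ip_norm; congr (expR (- _)); field; apply/andP.
have := expect_hermite_poly2 n m mX mY X2 Y2 g.
have i := intg_horner2 mX mY X2 Y2 g (hermite_poly n) (hermite_poly m).
rewrite [X in _ -> X = _](_ : _ = E (fun x => `|h| ^+ n * `|k| ^+ m *
    ((hermite_poly n).[X x] * (hermite_poly m).[Y x]))); last first.
  by congr expect; apply/funext => x; rewrite !hermiteE mulrACA.
rewrite expectZ// => ->.
have [<-|_] := eqVneq n m; last by rewrite !mul0r mulr0.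
rewrite !mul1r mulrCA; congr (_ * _).
by rewrite expr_div_n exprMn mulrC divfK// mulf_neq0// expf_neq0.
Qed.

End wiener.

(** * Symmetric Hilbert-Schmidt forms *)

Section finite_sums.
Context {R : realType}.

(** The squared distance from [v] to its projection on the rows of [V] is nonnegative. It will be
    applied with multi-indices for [J] and [A], the rows being tensor products of orthonormal
    vectors. *)
Lemma bessel_finite (J A : finType) (V : J -> A -> R) (v : A -> R) :
  (forall j l, \sum_a V j a * V l a = (j == l)%:R) ->
  \sum_j (\sum_a V j a * v a) ^+ 2 <= \sum_a v a ^+ 2.
Proof.
move=> VV; pose c j := \sum_a V j a * v a.
have s1 : \sum_a v a * (\sum_j c j * V j a) = \sum_j c j ^+ 2.
  under eq_bigr do rewrite mulr_sumr.
  rewrite exchange_big; apply: eq_bigr => j _; rewrite expr2 [X in _ = _ * X]/c mulr_sumr.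
  by apply: eq_bigr => a _; ring.
have s2 : \sum_a (\sum_j c j * V j a) ^+ 2 = \sum_j c j ^+ 2.
  transitivity (\sum_j \sum_l c j * c l * \sum_a V j a * V l a).
    under eq_bigr do rewrite expr2 mulr_suml.
    rewrite exchange_big; apply: eq_bigr => j _.
    under eq_bigr do rewrite mulr_sumr.
    rewrite exchange_big; apply: eq_bigr => l _; rewrite mulr_sumr.
    by apply: eq_bigr => a _; ring.
  apply: eq_bigr => j _; rewrite (bigD1 j)//= VV eqxx mulr1 big1 ?addr0//.
  by move=> l lj; rewrite VV eq_sym (negbTE lj) mulr0.
have : 0 <= \sum_a (v a - \sum_j c j * V j a) ^+ 2.
  by apply: sumr_ge0 => a _; exact: sqr_ge0.
under eq_bigr do rewrite sqrrB -mulr_natl.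
rewrite big_split sumrB /= s2 -mulr_sumr s1 -/c; lra.
Qed.

Lemma prod_nat_eq (I : finType) (J : I -> eqType) (f g : forall i, J i) :
  \prod_i ((f i == g i)%:R : R) = [forall i, f i == g i]%:R.
Proof.
case: (boolP [forall i, f i == g i]) => [/forallP h|].
  by rewrite big1// => i _; rewrite h.
by rewrite negb_forall => /existsP[i n]; rewrite (bigD1 i)//= (negbTE n) mul0r.
Qed.

Lemma sum_ffun_ord_recl (d n : nat) (F : ('I_n.+1 -> 'I_d) -> R) :
  (forall g h, g =1 h -> F g = F h) ->
  \sum_(i : {ffun 'I_n.+1 -> 'I_d}) F i =
  \sum_(a < d) \sum_(i : {ffun 'I_n -> 'I_d}) F (fun k => oapp i a (unlift ord0 k)).
Proof.
move=> eF; rewrite pair_big /=.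
pose cons (p : 'I_d * {ffun 'I_n -> 'I_d}) : {ffun 'I_n.+1 -> 'I_d} :=
  [ffun k => oapp p.2 p.1 (unlift ord0 k)].
pose uncons (i : {ffun 'I_n.+1 -> 'I_d}) := (i ord0, [ffun k => i (lift ord0 k)]).
rewrite (reindex cons) /=.
  by apply: eq_bigr => p _; apply: eF => k; rewrite ffunE.
exists uncons => [[a i] _|i _].
  rewrite /uncons /cons ffunE unlift_none /=; congr pair.
  by apply/ffunP => k; rewrite !ffunE liftK.
by apply/ffunP => k; rewrite ffunE; case: unliftP => [j|] -> /=; rewrite ?ffunE.
Qed.

Lemma sum_ffun_ord_split (d n m : nat) (F : ('I_n -> 'I_d) -> R) (G : ('I_m -> 'I_d) -> R) :
  (forall g h, g =1 h -> F g = F h) -> (forall g h, g =1 h -> G g = G h) ->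
  \sum_(i : {ffun 'I_(n + m) -> 'I_d})
     F (fun k => i (lshift m k)) * G (fun k => i (rshift n k)) =
  (\sum_(i : {ffun 'I_n -> 'I_d}) F i) * (\sum_(i : {ffun 'I_m -> 'I_d}) G i).
Proof.
move=> eF eG; rewrite mulr_suml.
under [RHS]eq_bigr do rewrite mulr_sumr.
rewrite pair_big /=.
pose join (p : {ffun 'I_n -> 'I_d} * {ffun 'I_m -> 'I_d}) : {ffun 'I_(n + m) -> 'I_d} :=
  [ffun k : 'I_(n + m) => match fintype.split k with inl a => p.1 a | inr b => p.2 b end].
pose unjoin (i : {ffun 'I_(n + m) -> 'I_d}) :=
  ([ffun k => i (lshift m k)], [ffun k => i (rshift n k)]).
rewrite (reindex join) /=.
  apply: eq_bigr => p _; congr (_ * _); [apply: eF|apply: eG] => k; rewrite ffunE.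
    by rewrite (unsplitK (inl k)).
  by rewrite (unsplitK (inr k)).
exists unjoin => [[a b] _|i _].
  rewrite /unjoin /join; congr pair; apply/ffunP => k; rewrite !ffunE.
    by rewrite (unsplitK (inl k)).
  by rewrite (unsplitK (inr k)).
apply/ffunP => k; rewrite ffunE; case: splitP => j e; rewrite ffunE; congr (i _);
  exact/val_inj.
Qed.

(* Inclusion-exclusion over the sets of indices kills the non-surjective maps. *)
Lemma polarization (n : nat) (x : 'I_n -> 'I_n -> R) :
  \sum_(S : {set 'I_n}) (\prod_i (if i \in S then 1 else -1)) *
     \prod_j \sum_(k in S) x k j =
  \sum_(s : 'S_n) \prod_j x (s j) j.
Proof.
(* [D S phi] is the sign of [S] when [phi] takes its values in [S], and 0 otherwise. Being a product
   over single indices, it sums over [S] to a product whose factor at [i] is 1 if [phi] attains [i]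
   and 0 if not. *)
pose D (S : {set 'I_n}) (phi : {ffun 'I_n -> 'I_n}) : R :=
  \prod_i (if i \in S then 1 else if i \in codom phi then 0 else -1).
have step (S : {set 'I_n}) : (\prod_i (if i \in S then 1 else -1)) * \prod_j \sum_(k in S) x k j =
    \sum_(phi : {ffun 'I_n -> 'I_n}) D S phi * \prod_j x (phi j) j.
  rewrite bigA_distr_big /= mulr_sumr.
  rewrite [RHS](bigID [pred phi : {ffun 'I_n -> 'I_n} | phi \in ffun_on (mem S)]) /=.
  rewrite [X in _ = _ + X]big1 ?addr0.
    apply: eq_bigr => phi /ffun_onP phiS; congr (_ * _); apply: eq_bigr => i _.
    case: ifP => // iS; case: ifP => // /codomP[j ij].
    by move: iS; rewrite ij phiS.
  move=> phi /ffun_onP phiS.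
  have [j jS] : exists j, phi j \notin S.
    by apply/existsP; rewrite -negb_forall; apply/forallP => h; apply: phiS.
  by rewrite /D (bigD1 (phi j))//= (negbTE jS) codom_f !mul0r.
rewrite (eq_bigr _ (fun S _ => step S)) exchange_big /=.
have DE phi : \sum_(S : {set 'I_n}) D S phi =
    \prod_i (1 + (if i \in codom phi then 0 else -1)) by rewrite bigA_distr.
under eq_bigr => phi _ do rewrite -mulr_suml DE.
rewrite (bigID (fun phi : {ffun 'I_n -> 'I_n} => injectiveb phi)) /=.
rewrite [X in _ + X]big1 ?addr0; last first.
  move=> phi /injectiveP ninj.
  have [i ic] : exists i, i \notin codom phi.
    apply/existsP; rewrite -negb_forall; apply/forallP => h; apply: ninj.
    have /eqP/image_injP inj : #|codom phi| = #|'I_n|.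
    by apply: eq_card => i; rewrite h.
  by move=> a b; exact: inj.
  by rewrite (bigD1 i)//= (negbTE ic) subrr !mul0r.
rewrite (reindex (@pval _)) /=; last first.
  pose in_Sn := insubd (1%g : 'S_n).
  by exists in_Sn => /= f Uf; first apply: val_inj; apply: insubdK.
apply: eq_big => /= [s | s _]; rewrite ?(valP s)//.
rewrite [X in X * _]big1 ?mul1r; first by apply: eq_bigr => j _; rewrite pvalE.
by move=> i _; rewrite ifT ?addr0//; apply/codomP; exists ((s^-1)%g i); rewrite pvalE permKV.
Qed.

End finite_sums.

(** * Expansion of multilinear forms *)

Section multilinear.
Context {R : realType} {H : completeNormedModType R}.

Definition cons_arg n (v : H) (h : 'I_n -> H) : 'I_n.+1 -> H :=
  fun k => oapp h v (unlift ord0 k).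

Lemma multilinear_sum n (f : ('I_n -> H) -> R) (i : 'I_n) h (d : nat)
    (c : 'I_d -> R) (u : 'I_d -> H) : multilinear_form f ->
  f [eta h with i |-> \sum_a c a *: u a] = \sum_a c a * f [eta h with i |-> u a].
Proof.
move=> mf; have f0 : f [eta h with i |-> 0] = 0.
  by have := mf i h 1 0 0; rewrite scaler0 addr0 mul1r => h0; lra.
elim/big_rec2: _ => [//|a x y _ ih]; by rewrite mf ih.
Qed.

Lemma cons_arg_with0 n (v w : H) (h : 'I_n -> H) :
  cons_arg w h = [eta (cons_arg v h) with ord0 |-> w].
Proof.
apply/funext => k /=; rewrite /cons_arg; case: unliftP => [j|] ->//=.
Qed.

Lemma cons_arg_lift n (v w : H) (h : 'I_n -> H) (i : 'I_n) :
  cons_arg v [eta h with i |-> w] = [eta (cons_arg v h) with lift ord0 i |-> w].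
Proof.
apply/funext => k /=; rewrite /cons_arg; case: unliftP => [j|] ->/=.
  by rewrite (inj_eq lift_inj).
by [].
Qed.

Lemma multilinear_cons n (f : ('I_n.+1 -> H) -> R) v :
  multilinear_form f -> multilinear_form (fun h : 'I_n -> H => f (cons_arg v h)).
Proof. by move=> mf i h a x y; rewrite !cons_arg_lift mf. Qed.

Lemma multilinear_expand n (f : ('I_n -> H) -> R) (d : nat) (e : 'I_d -> H)
    (c : 'I_n -> 'I_d -> R) : multilinear_form f ->
  f (fun k => \sum_a c k a *: e a) =
  \sum_(i : {ffun 'I_n -> 'I_d}) (\prod_k c k (i k)) * f (fun k => e (i k)).
Proof.
elim: n f c => [|n ih] f c mf.
  rewrite (big_pred1 (ffun0 (card_ord 0))); last first.
    by move=> i /=; apply/esym/eqP/ffunP => -[].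
  by rewrite big_ord0 mul1r; congr f; apply/funext => -[].
rewrite (sum_ffun_ord_recl (F := fun i => (\prod_k c k (i k)) * f (fun k => e (i k)))); last first.
  by move=> g h gh; rewrite (funext gh).
(* The head 0 is a placeholder, overwritten at [ord0]; this shape lets linearity in the first
   argument apply. *)
have -> : (fun k => \sum_a c k a *: e a) =
    [eta (cons_arg 0 (fun k => \sum_a c (lift ord0 k) a *: e a)) with ord0 |->
      \sum_a c ord0 a *: e a].
  rewrite -(cons_arg_with0 0); apply/funext => k; rewrite /cons_arg.
  by case: unliftP => [j|] ->.
rewrite multilinear_sum//; apply: eq_bigr => a _.
rewrite -(cons_arg_with0 0) (ih (fun h => f (cons_arg (e a) h))); last exact: multilinear_cons.
rewrite mulr_sumr; apply: eq_bigr => i _.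
rewrite big_ord_recl unlift_none /= -mulrA; congr (_ * (_ * _)).
  by apply: eq_bigr => k _; rewrite liftK.
by congr f; apply/funext => k; rewrite /cons_arg; case: unliftP.
Qed.

End multilinear.

(** * Finite orthonormal families *)

Section gram_schmidt.
Context {R : realType} {H : completeNormedModType R} (ip : {dot H for idfun}).

(** For orthonormal [e], being equal to one's own orthogonal projection is membership in the linear
    span; the Fourier expansion is the form that the computations use. *)
Definition in_span d (e : 'I_d -> H) (v : H) : Prop :=
  v = \sum_a ip v (e a) *: e a.

Lemma in_spanZD d (e : 'I_d -> H) a u v :
  in_span e u -> in_span e v -> in_span e (a *: u + v).
Proof.
rewrite /in_span => {1}-> {1}->; rewrite scaler_sumr -big_split.
by apply: eq_bigr => i _; rewrite ipDl ipZl scalerA scalerDl.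
Qed.

Lemma in_span0 d (e : 'I_d -> H) : in_span e 0.
Proof. by rewrite /in_span big1// => a _; rewrite ipC ip0r scale0r. Qed.

Lemma in_span_base d (e : 'I_d -> H) a : orthonormal_family ip e -> in_span e (e a).
Proof.
move=> on; rewrite /in_span (bigD1 a)//= on eqxx scale1r big1 ?addr0// => b ba.
by rewrite on eq_sym (negbTE ba) scale0r.
Qed.

Lemma in_span_sub d d' (e : 'I_d -> H) (e' : 'I_d' -> H) (iota : 'I_d -> 'I_d') v :
  orthonormal_family ip e' -> e' \o iota = e -> in_span e v -> in_span e' v.
Proof.
move=> on <- ->; elim/big_rec: _ => [|a x _ ih]; first exact: in_span0.
by apply: in_spanZD => //; exact: in_span_base.
Qed.

Lemma in_span_parseval d (e : 'I_d -> H) u v : in_span e u ->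
  ip u v = \sum_a ip u (e a) * ip v (e a).
Proof.
move=> {1}->; rewrite ip_suml; apply: eq_bigr => a _.
by rewrite ipZl [ip (e a) v]ipC.
Qed.

Lemma bessel d (e : 'I_d -> H) (h : H) : orthonormal_family ip e ->
  \sum_a ip h (e a) ^+ 2 <= ip h h.
Proof.
move=> on; pose p := \sum_a ip h (e a) *: e a.
have := ip_ge0 ip (h - p).
have e1 : ip h p = \sum_a ip h (e a) ^+ 2.
  by rewrite ip_sumr; apply: eq_bigr => a _; rewrite ipZr expr2.
have e2 : ip p p = \sum_a ip h (e a) ^+ 2.
  rewrite {2}/p ip_sumr; apply: eq_bigr => a _; rewrite ipZr expr2; congr (_ * _).
  rewrite ip_suml (bigD1 a)//= ipZl on eqxx mulr1 big1 ?addr0// => b ba.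
  by rewrite ipZl on (negbTE ba) mulr0.
by rewrite ipBl !ipBr [ip p h]ipC e2 e1; lra.
Qed.

(** The residual of [v] is either 0, and nothing is added, or its normalization is put at index
    [ord0]. The map [iota] records where the old vectors sit, since the new size depends on the
    case. *)
Lemma gram_schmidt_step d (e : 'I_d -> H) (v : H) : orthonormal_family ip e ->
  exists d' (e' : 'I_d' -> H) (iota : 'I_d -> 'I_d'),
  [/\ orthonormal_family ip e', e' \o iota = e & in_span e' v].
Proof.
move=> on; pose p := \sum_a ip v (e a) *: e a; pose w := v - p.
have [w0|w0] := eqVneq w 0.
  exists d, e, id; split => //; rewrite /in_span -/p.
  by apply/eqP; rewrite -subr_eq0 -/w w0.
have we a : ip w (e a) = 0.
  rewrite ipBl ip_suml (bigD1 a)//= ipZl on eqxx mulr1 big1 ?addr0 ?subrr// => b ba.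
  by rewrite ipZl on (negbTE ba) mulr0.
have ww := ip_gt0 ip w0.
pose u := (Num.sqrt (ip w w))^-1 *: w.
have s0 : Num.sqrt (ip w w) != 0 by rewrite gt_eqF// sqrtr_gt0.
have uu : ip u u = 1.
  rewrite ipZl ipZr mulrA -invfM -expr2 sqr_sqrtr ?ltW// mulVf// gt_eqF//.
have ue a : ip u (e a) = 0 by rewrite ipZl we mulr0.
pose e' (k : 'I_d.+1) : H := oapp e u (unlift ord0 k).
have on' : orthonormal_family ip e'.
  move=> i j; rewrite /e'; case: unliftP => [k|] ->; case: unliftP => [l|] -> /=.
  - by rewrite on (inj_eq lift_inj).
  - by rewrite ipC ue.
  - by rewrite ue.
  - by rewrite uu.
exists d.+1, e', (lift ord0); split => //.
  by apply/funext => a; rewrite /e' /= liftK.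
have -> : v = Num.sqrt (ip w w) *: e' ord0 + p.
  by rewrite /e' unlift_none /= scalerA mulfV// scale1r subrK.
apply: in_spanZD; first exact: in_span_base.
apply: (@in_span_sub _ _ e e' (lift ord0)) => //.
  by apply/funext => a; rewrite /e' /= liftK.
elim/big_rec: (p) => [|a x _ ih]; first exact: in_span0.
by apply: in_spanZD => //; exact: in_span_base.
Qed.

Lemma gram_schmidt d (e : 'I_d -> H) (s : seq H) : orthonormal_family ip e ->
  exists d' (e' : 'I_d' -> H) (iota : 'I_d -> 'I_d'),
  [/\ orthonormal_family ip e', e' \o iota = e & forall v, v \in s -> in_span e' v].
Proof.
move=> on; elim: s => [|v s [d1 [e1 [i1 [on1 ei1 sp1]]]]].
  by exists d, e, id; split.
have [d2 [e2 [i2 [on2 ei2 sp2]]]] := gram_schmidt_step v on1.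
exists d2, e2, (i2 \o i1); split => //; first by rewrite -ei1 -ei2.
move=> w; rewrite in_cons => /predU1P[->//|/sp1 sw].
exact: in_span_sub on2 ei2 sw.
Qed.

End gram_schmidt.

(** * Hilbert-Schmidt norms and finite compressions *)

Section hs_norm.
Context {R : realType} {H : completeNormedModType R} (ip : {dot H for idfun}).

Lemma ffun_eqE (A : finType) (B : eqType) (f g : {ffun A -> B}) :
  [forall i, f i == g i] = (f == g).
Proof. by apply/forallP/eqP => [h|->//]; apply/ffunP => k; exact/eqP. Qed.

Definition hs_sum n d (e : 'I_d -> H) (f : ('I_n -> H) -> R) : R :=
  \sum_(i : {ffun 'I_n -> 'I_d}) f (fun k => e (i k)) ^+ 2.

Lemma hs_norm2_le n (f : ('I_n -> H) -> R) (C : R) :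
  (forall d (e : 'I_d -> H), orthonormal_family ip e -> hs_sum e f <= C) ->
  (hs_norm2 ip f <= C%:E)%E.
Proof.
move=> fC; apply: ge_ereal_sup => _ [d [e on ->]].
by rewrite lee_fin; exact: fC.
Qed.

Lemma hs_sum_le n d (e : 'I_d -> H) (f : ('I_n -> H) -> R) :
  orthonormal_family ip e -> ((hs_sum e f)%:E <= hs_norm2 ip f)%E.
Proof. by move=> on; apply: ereal_sup_ubound; exists d, e. Qed.

Lemma hs_norm2_ge0 n (f : ('I_n -> H) -> R) : (0 <= hs_norm2 ip f)%E.
Proof.
have on : orthonormal_family ip (fun i : 'I_0 => 0) by move=> [].
apply: le_trans (hs_sum_le f on); rewrite lee_fin.
by apply: sumr_ge0 => i _; exact: sqr_ge0.
Qed.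

Lemma hs_norm2_fin n (f : ('I_n -> H) -> R) : sym_tensor ip f ->
  hs_norm2 ip f = (fine (hs_norm2 ip f))%:E.
Proof. by move=> [_ _ f1]; rewrite fineK// ge0_fin_numE// hs_norm2_ge0. Qed.

Lemma hs_sum_fine n d (e : 'I_d -> H) (f : ('I_n -> H) -> R) : sym_tensor ip f ->
  orthonormal_family ip e -> hs_sum e f <= fine (hs_norm2 ip f).
Proof. by move=> sf on; rewrite -lee_fin -hs_norm2_fin//; exact: hs_sum_le. Qed.

Lemma hs_sum_approx n (f : ('I_n -> H) -> R) (eps : R) : sym_tensor ip f -> 0 < eps ->
  exists d, exists2 e : 'I_d -> H, orthonormal_family ip e &
    fine (hs_norm2 ip f) - eps < hs_sum e f.
Proof.
move=> sf eps0.
have fn : hs_norm2 ip f \is a fin_num by rewrite hs_norm2_fin.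
have [_ [d [e on ->]] lt] := ub_ereal_sup_adherent eps0 fn.
exists d, e => //; move: lt; rewrite -/(hs_norm2 ip f) hs_norm2_fin//.
Qed.

Lemma sym_tensorZD n (a : R) (f g : ('I_n -> H) -> R) :
  sym_tensor ip f -> sym_tensor ip g -> sym_tensor ip (fun h => a * f h + g h).
Proof.
move=> sf sg; have [mf syf _] := sf; have [mg syg _] := sg; split.
- move=> i h b u v; rewrite mf mg.
  move: (f [eta h with i |-> u]) (f [eta h with i |-> v]) => x y.
  by move: (g [eta h with i |-> u]) (g [eta h with i |-> v]) => z t; ring.
- by move=> s h; rewrite syf syg.
- apply: (@le_lt_trans _ _
   (2 * a ^+ 2 * fine (hs_norm2 ip f) + 2 * fine (hs_norm2 ip g))%:E); last exact: ltry.
  apply: hs_norm2_le => d e on.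
  apply: (@le_trans _ _ (2 * a ^+ 2 * hs_sum e f + 2 * hs_sum e g)).
    rewrite /hs_sum !mulr_sumr -big_split; apply: ler_sum => i _ /=.
    by have := sqr_ge0 (a * f (fun k => e (i k)) - g (fun k => e (i k))); nra.
  apply: lerD; apply: ler_wpM2l; rewrite ?hs_sum_fine//.
  by rewrite mulr_ge0// sqr_ge0.
Qed.

Lemma prod_update n (F : 'I_n -> H -> R) (i : 'I_n) (h : 'I_n -> H) w :
  \prod_k F k ([eta h with i |-> w] k) = F i w * \prod_(k | k != i) F k (h k).
Proof.
rewrite (bigD1 i)//= eqxx; congr (_ * _).
by apply: eq_bigr => k ki; rewrite /= (negbTE ki).
Qed.

Lemma tensor_pow_sym n (h : H) : sym_tensor ip (tensor_pow ip h : ('I_n -> H) -> R).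
Proof.
split.
- move=> i k a u v; rewrite /tensor_pow !(prod_update (fun _ w => ip h w)).
  by rewrite ipDr ipZr mulrDl mulrA.
- move=> s k; rewrite /tensor_pow [RHS](reindex_inj (@perm_inj _ s)).
  by [].
- apply: (@le_lt_trans _ _ (ip h h ^+ n)%:E); last exact: ltry.
  apply: hs_norm2_le => d e on.
  rewrite /hs_sum /tensor_pow.
  under eq_bigr do rewrite -prodrXl.
  rewrite -(bigA_distr_bigA (fun _ a => ip h (e a) ^+ 2)).
  rewrite prodr_const card_ord lerXn2r// ?nnegrE.
  + by apply: sumr_ge0 => a _; exact: sqr_ge0.
  + exact: ip_ge0.
  + exact: bessel.
Qed.

Lemma sym_tensor0 n : sym_tensor ip (fun _ : 'I_n -> H => 0).
Proof.
split; [by move=> *; rewrite mulr0 addr0|by []|].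
apply: (@le_lt_trans _ _ 0%:E); last exact: ltry.
by apply: hs_norm2_le => d e on; rewrite /hs_sum big1// => i _; rewrite expr0n.
Qed.

(** For multilinear [f] this is [f] with every argument first projected orthogonally onto the span
    of [e], written as a combination of elementary tensors. *)
Definition form_proj n d (e : 'I_d -> H) (f : ('I_n -> H) -> R) : ('I_n -> H) -> R :=
  fun h => \sum_(i : {ffun 'I_n -> 'I_d}) f (fun k => e (i k)) * \prod_k ip (e (i k)) (h k).

Lemma form_proj_multilinear n d (e : 'I_d -> H) (f : ('I_n -> H) -> R) :
  multilinear_form (form_proj e f).
Proof.
move=> i h a u v; rewrite /form_proj mulr_sumr -big_split.
apply: eq_bigr => j _ /=; rewrite mulrCA -mulrDr; congr (_ * _).
rewrite !(prod_update (fun k w => ip (e (j k)) w)).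
by rewrite ipDr ipZr mulrDl mulrA.
Qed.

(** In the larger family the compression has nonzero coordinates only at multi-indices coming from
    [iota]. Taking [G] to be [f] or the compression itself gives the inner products needed for
    Pythagoras. *)
Lemma form_proj_embed n d d' (e : 'I_d -> H) (e' : 'I_d' -> H) (iota : 'I_d -> 'I_d')
    (f : ('I_n -> H) -> R) (G : ('I_n -> H) -> R) :
  orthonormal_family ip e' -> e' \o iota = e ->
  \sum_(j : {ffun 'I_n -> 'I_d'}) G (fun k => e' (j k)) * form_proj e f (fun k => e' (j k)) =
  \sum_(i : {ffun 'I_n -> 'I_d}) G (fun k => e (i k)) * f (fun k => e (i k)).
Proof.
move=> on ei; rewrite /form_proj.
under eq_bigr do rewrite mulr_sumr.
rewrite exchange_big; apply: eq_bigr => i _ /=.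
pose j0 : {ffun 'I_n -> 'I_d'} := [ffun k => iota (i k)].
have ipE (j : {ffun 'I_n -> 'I_d'}) : \prod_k ip (e (i k)) (e' (j k)) = (j0 == j)%:R.
  rewrite (eq_bigr (fun k => (j0 k == j k)%:R)); last first.
    by move=> k _; rewrite -ei on ffunE.
  by rewrite prod_nat_eq ffun_eqE.
rewrite (bigD1 j0)//= ipE eqxx mulr1 big1 ?addr0.
  by congr (G _ * _); apply/funext => k; rewrite ffunE -ei.
by move=> j jj; rewrite ipE eq_sym (negbTE jj) !mulr0.
Qed.

Lemma form_proj_base n d (e : 'I_d -> H) (f : ('I_n -> H) -> R) (i : {ffun 'I_n -> 'I_d}) :
  orthonormal_family ip e -> form_proj e f (fun k => e (i k)) = f (fun k => e (i k)).
Proof.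
move=> on; rewrite /form_proj (bigD1 i)//= [X in f _ * X]big1 ?mulr1.
  rewrite big1 ?addr0// => j ji.
  have [k jk] : exists k, j k != i k.
    apply/existsP; rewrite -negb_forall; apply/forallP => h.
    by move/eqP: ji; apply; apply/ffunP => k; exact/eqP.
  by rewrite (bigD1 k)//= on (negbTE jk) mul0r mulr0.
by move=> k _; rewrite on eqxx.
Qed.

(** Pythagoras for [f] and its compression. The supremum ranges over arbitrary families [e1],
    unrelated to [e]; Gram-Schmidt extends [e] to an [e'] whose span contains [e1], Bessel passes
    from [e1] to [e'], and in [e'] the computation is exact. The difference is written with [-1 *]
    to match [mi_linear]. *)
Lemma hs_norm2_sub_proj n d (e : 'I_d -> H) (f : ('I_n -> H) -> R) :
  sym_tensor ip f -> orthonormal_family ip e ->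
  (hs_norm2 ip (fun h => -1 * form_proj e f h + f h)%R <=
     (fine (hs_norm2 ip f) - hs_sum e f)%:E)%E.
Proof.
move=> sf on; have [mf _ _] := sf; apply: hs_norm2_le => d1 e1 on1.
have [d' [e' [iota [on' ei sp]]]] := gram_schmidt [seq e1 j | j <- enum 'I_d1] on.
pose g h := -1 * form_proj e f h + f h.
have mg : multilinear_form g.
  move=> i h a u v; rewrite /g form_proj_multilinear mf.
  move: (f [eta h with i |-> u]) (f [eta h with i |-> v]) => x y.
  by move: (form_proj e f [eta h with i |-> u]) (form_proj e f [eta h with i |-> v]) => z t; ring.
pose U j a := ip (e1 j) (e' a).
have e1E j : e1 j = \sum_a U j a *: e' a.
  by apply: sp; apply/mapP; exists j => //; rewrite mem_enum.
have UU j l : \sum_a U j a * U l a = (j == l)%:R.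
  by rewrite -on1 (in_span_parseval _ (e1E j)).
have le1 : hs_sum e1 g <= hs_sum e' g.
  rewrite /hs_sum.
  under eq_bigr => j _.
    rewrite (_ : (fun k => e1 (j k)) = fun k => \sum_a U (j k) a *: e' a); last first.
      by apply/funext => k.
    rewrite (multilinear_expand e' (fun k => U (j k)) mg); over.
  (* The rows are tensor powers of the coordinate matrix [U] of [e1] in [e']; their inner products
     factor into Kronecker deltas. *)
  apply: (bessel_finite (V := fun (j : {ffun 'I_n -> 'I_d1}) (i : {ffun 'I_n -> 'I_d'}) =>
    \prod_k U (j k) (i k))) => j l.
  under eq_bigr do rewrite -big_split.
  rewrite -(bigA_distr_bigA (fun k a => U (j k) a * U (l k) a)).
  rewrite (eq_bigr (fun k => (j k == l k)%:R)) => [|k _]; last exact: UU.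
  by rewrite prod_nat_eq ffun_eqE.
apply: (le_trans le1).
suff -> : hs_sum e' g = hs_sum e' f - hs_sum e f.
  by apply: lerB => //; exact: hs_sum_fine.
have c1 : \sum_(j : {ffun 'I_n -> 'I_d'})
    f (fun k => e' (j k)) * form_proj e f (fun k => e' (j k)) = hs_sum e f.
  by rewrite (form_proj_embed _ _ on' ei); apply: eq_bigr => i _; rewrite expr2.
have c2 : hs_sum e' (form_proj e f) = hs_sum e f.
  rewrite /hs_sum; under eq_bigr do rewrite expr2.
  rewrite (form_proj_embed _ _ on' ei); apply: eq_bigr => i _.
  by rewrite form_proj_base// expr2.
transitivity (hs_sum e' f - 2 * hs_sum e f + hs_sum e f); last by ring.
rewrite -{1}c1 -[X in _ = _ + X]c2 /hs_sum mulr_sumr -sumrB -big_split.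
by apply: eq_bigr => j _; rewrite /g /=; ring.
Qed.

End hs_norm.

(** * Combinations of powers and symmetric products *)

Section symmetric.
Context {R : realType} {H : completeNormedModType R} (ip : {dot H for idfun}).

Definition pow_comb n (s : seq (R * H)) : ('I_n -> H) -> R :=
  fun h => \sum_(p <- s) p.1 * tensor_pow ip p.2 h.

Lemma pow_comb_sym n s : sym_tensor ip (@pow_comb n s).
Proof.
elim: s => [|p s ih].
  rewrite (_ : pow_comb [::] = fun=> 0); first exact: sym_tensor0.
  by apply/funext => h; rewrite /pow_comb big_nil.
rewrite (_ : pow_comb (p :: s) = fun h => p.1 * tensor_pow ip p.2 h + pow_comb s h).
  by apply: sym_tensorZD => //; exact: tensor_pow_sym.
by apply/funext => h; rewrite /pow_comb big_cons.
Qed.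

Lemma sum_ffun_perm n d (s : 'S_n) (F : {ffun 'I_n -> 'I_d} -> R) :
  \sum_(i : {ffun 'I_n -> 'I_d}) F [ffun k => i (s k)] = \sum_i F i.
Proof.
rewrite [RHS](reindex_inj (h := fun i : {ffun 'I_n -> 'I_d} => [ffun k => i (s k)]))//.
move=> i j /ffunP h; apply/ffunP => k.
by have := h ((s^-1)%g k); rewrite !ffunE permKV.
Qed.

(** Symmetry of [f] allows averaging the elementary tensors over permutations, and [polarization]
    writes each average as a signed sum of powers of the partial sums of the [e (i k)]; hence the
    factor 1/n! in [term]. *)
Lemma form_proj_pow_comb n d (e : 'I_d -> H) (f : ('I_n -> H) -> R) :
  Defs.symmetric_form f -> exists s, form_proj ip e f = pow_comb s.
Proof.
move=> sf.
pose term (i : {ffun 'I_n -> 'I_d}) (S : {set 'I_n}) : R * H :=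
  (f (fun k => e (i k)) / n`!%:R * \prod_k (if k \in S then 1 else -1),
   \sum_(k in S) e (i k)).
exists [seq term i A | i <- enum {ffun 'I_n -> 'I_d}, A <- enum {set 'I_n}].
apply/funext => h; rewrite /pow_comb big_allpairs_dep big_enum /=.
have nf0 : (n`!%:R : R) != 0 by rewrite pnatr_eq0 -lt0n fact_gt0.
transitivity (\sum_(i : {ffun 'I_n -> 'I_d}) \sum_(s : 'S_n)
    (n`!%:R^-1 * (f (fun k => e (i k)) * \prod_j ip (e (i (s j))) (h j)))).
  rewrite exchange_big /=.
  rewrite (eq_bigr (fun=> n`!%:R^-1 * form_proj ip e f h)).
    by rewrite sumr_const card_Sn -mulrnAl -[_ *+ _]mulr_natl mulfV// mul1r.
  move=> s _; rewrite -mulr_sumr; congr (_ * _).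
  rewrite /form_proj -[RHS](sum_ffun_perm s).
  apply: eq_bigr => i _; congr (_ * _).
    by rewrite -[LHS](sf s); congr f; apply/funext => k /=; rewrite ffunE.
  by apply: eq_bigr => j _; rewrite ffunE.
apply: eq_bigr => i _; rewrite big_enum /= -mulr_sumr.
rewrite -mulr_sumr -(polarization (fun k j => ip (e (i k)) (h j))) !mulr_sumr.
apply: eq_bigr => A _; rewrite /tensor_pow /=.
rewrite [X in _ = _ * X](eq_bigr (fun j => \sum_(k in A) ip (e (i k)) (h j))); last first.
  by move=> j _; rewrite ip_suml.
by move: (\prod_j _) (\prod_j _) (f _) => x y z; ring.
Qed.

Lemma sqr_sum_le (I : finType) (x : I -> R) :
  (\sum_i x i) ^+ 2 <= #|I|%:R * \sum_i x i ^+ 2.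
Proof.
have [I0|I0] := posnP #|I|.
  rewrite big_pred0 ?expr0n ?I0 ?mul0r// => i.
  by have := fintype0 i I0.
set A := \sum_i x i; set N : R := #|I|%:R.
have N0 : 0 < N by rewrite ltr0n.
have : 0 <= \sum_i (N * x i - A) ^+ 2 by apply: sumr_ge0 => i _; exact: sqr_ge0.
have -> : \sum_i (N * x i - A) ^+ 2 = N * (N * \sum_i x i ^+ 2 - A ^+ 2).
  rewrite (eq_bigr (fun i => N ^+ 2 * x i ^+ 2 - 2 * N * A * x i + A ^+ 2)); last first.
    by move=> i _; ring.
  rewrite big_split sumrB /= -!mulr_sumr sumr_const -/A -mulr_natl -/N; ring.
by rewrite pmulr_rge0// subr_ge0.
Qed.

Lemma tensor_prod_multilinear n m (f : ('I_n -> H) -> R) (g : ('I_m -> H) -> R) :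
  multilinear_form f -> multilinear_form g -> multilinear_form (tensor_prod f g).
Proof.
move=> mf mg i h a u v; rewrite /tensor_prod.
case: (split_ordP i) => j ->.
  have fE w : (fun k => [eta h with lshift m j |-> w] (lshift m k)) =
      [eta (fun k => h (lshift m k)) with j |-> w].
    by apply/funext => k /=; rewrite eq_lshift.
  have gE w : (fun k => [eta h with lshift m j |-> w] (rshift n k)) =
      (fun k => h (rshift n k)).
    by apply/funext => k /=; rewrite eq_rlshift.
  rewrite !fE !gE mf.
  by rewrite mulrDl mulrA.
have gE w : (fun k => [eta h with rshift n j |-> w] (rshift n k)) =
    [eta (fun k => h (rshift n k)) with j |-> w].
  by apply/funext => k /=; rewrite eq_rshift.
have fE w : (fun k => [eta h with rshift n j |-> w] (lshift m k)) =
    (fun k => h (lshift m k)).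
  by apply/funext => k /=; rewrite eq_lrshift.
by rewrite !fE !gE mg mulrDr mulrCA.
Qed.

Lemma symmetrize_multilinear n (f : ('I_n -> H) -> R) :
  multilinear_form f -> multilinear_form (symmetrize f).
Proof.
move=> mf i h a u v; rewrite /symmetrize mulrCA -mulrDr; congr (_ * _).
rewrite mulr_sumr -big_split; apply: eq_bigr => s _ /=.
have e w : [eta h with i |-> w] \o s = [eta (h \o s) with (s^-1)%g i |-> w].
  by apply/funext => k /=; rewrite (canF_eq (permK s)) .
by rewrite !e mf.
Qed.

Lemma symmetrize_symmetric n (f : ('I_n -> H) -> R) : Defs.symmetric_form (symmetrize f).
Proof.
move=> t h; rewrite /symmetrize; congr (_ * _).
rewrite [RHS](reindex_inj (mulIg t)); apply: eq_bigr => s _; congr f.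
by apply/funext => k /=; rewrite permM.
Qed.

(** Symmetrization does not increase the norm: the square of an average is at most the average of
    the squares, and permuting multi-indices leaves each sum unchanged. The unsymmetrized product
    has a sum that factors. *)
Lemma sym_prod_hs n m (f : ('I_n -> H) -> R) (g : ('I_m -> H) -> R) :
  sym_tensor ip f -> sym_tensor ip g ->
  (hs_norm2 ip (sym_prod f g) <=
    (fine (hs_norm2 ip f) * fine (hs_norm2 ip g))%:E)%E.
Proof.
move=> sf sg; apply: hs_norm2_le => d e on; set N := (n + m)%N.
have N0 : 0 < N`!%:R :> R by rewrite ltr0n fact_gt0.
pose T i := tensor_prod f g (fun k => e (i k)).
apply: (@le_trans _ _ (\sum_(i : {ffun 'I_N -> 'I_d}) N`!%:R^-1 *
    \sum_(s : 'S_N) T (fun k => i (s k)) ^+ 2)).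
  apply: ler_sum => i _; rewrite /sym_prod /symmetrize exprMn expr2 -mulrA.
  apply: ler_wpM2l; first by rewrite invr_ge0 ltW.
  rewrite ler_pdivrMl//.
  by apply: (le_trans (sqr_sum_le _)); rewrite card_Sn.
rewrite -mulr_sumr exchange_big /=.
rewrite (eq_bigr (fun=> hs_sum e f * hs_sum e g)).
  rewrite sumr_const card_Sn -(mulr_natl (_ * _)) mulKf ?gt_eqF//.
  apply: ler_pM; rewrite ?hs_sum_fine//; apply: sumr_ge0 => i _; exact: sqr_ge0.
move=> s _.
rewrite (eq_bigr (fun i : {ffun 'I_N -> 'I_d} =>
    T ([ffun k => i (s k)] : {ffun 'I_N -> 'I_d}) ^+ 2)); last first.
  move=> i _; congr (_ ^+ 2); rewrite /T; congr tensor_prod.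
  by apply/funext => k; rewrite ffunE.
rewrite (sum_ffun_perm s (fun i => T i ^+ 2)) /hs_sum.
rewrite -(sum_ffun_ord_split (F := fun i => f (fun k => e (i k)) ^+ 2)
                             (G := fun i => g (fun k => e (i k)) ^+ 2)).
- by apply: eq_bigr => i _; rewrite /T /tensor_prod exprMn.
- by move=> i j ij; rewrite (funext ij).
- by move=> i j ij; rewrite (funext ij).
Qed.

Lemma sym_prod_sym_tensor n m (f : ('I_n -> H) -> R) (g : ('I_m -> H) -> R) :
  sym_tensor ip f -> sym_tensor ip g -> sym_tensor ip (sym_prod f g).
Proof.
move=> sf sg; split.
- apply: symmetrize_multilinear; apply: tensor_prod_multilinear.
    by have [] := sf.
  by have [] := sg.
- exact: symmetrize_symmetric.
- exact: le_lt_trans (sym_prod_hs sf sg) (ltry _).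
Qed.

End symmetric.

(** * Norms and orthogonality of multiple integrals *)

Section L2_limits.
Context {d} {T : measurableType d} {R : realType} (P : probability T R).
Implicit Types f g : T -> R.
Local Notation E := (expect P).
Local Notation intg := (intg P).
Local Notation sqintg := (sqintg P).

Lemma expect_cauchy_schwarz f g : sqintg f -> sqintg g ->
  E (fun x => f x * g x) ^+ 2 <= E (fun x => f x ^+ 2) * E (fun x => g x ^+ 2).
Proof.
move=> sf sg.
set a := E (fun x => f x ^+ 2); set b := E _; set c := E (fun x => g x ^+ 2).
have a0 : 0 <= a by apply: expect_ge0 => x; exact: sqr_ge0.
have c0 : 0 <= c by apply: expect_ge0 => x; exact: sqr_ge0.
have quad t : 0 <= a + (2 * t * b + t ^+ 2 * c).
  have := @expect_ge0 _ _ _ P (fun x => (f x + t * g x) ^+ 2) (fun x => sqr_ge0 _).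
  rewrite (_ : (fun x => _) = (fun x => f x ^+ 2 +
      ((2 * t) * (f x * g x) + t ^+ 2 * g x ^+ 2))); last first.
    by apply/funext => x; ring.
  have i1 : intg (fun x => (2 * t) * (f x * g x)) by apply: intgZ; exact: sqintgM.
  have i2 : intg (fun x => t ^+ 2 * g x ^+ 2) by apply: intgZ; exact: sg.2.
  rewrite (expectD sf.2 (intgD i1 i2)) (expectD i1 i2).
  by rewrite (expectZ _ (sqintgM sf sg)) (expectZ _ sg.2).
have [c00|cn0] := eqVneq c 0.
  have [->|b0] := eqVneq b 0; first by rewrite expr0n mulr_ge0.
  (* When [c = 0] the quadratic is affine in [t]; this [t] would give it the value -1. *)
  have := quad (- (a + 1) / (2 * b)); rewrite c00 mulr0 addr0.
  rewrite (_ : 2 * _ * b = - (a + 1)); first by lra.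
  by field.
have cp : 0 < c by rewrite lt_neqAle eq_sym cn0.
have := quad (- b / c).
rewrite (_ : a + _ = (a * c - b ^+ 2) / c); last by field.
by rewrite pmulr_lge0 ?invr_gt0// subr_ge0.
Qed.

Lemma expect_mul_le f g : sqintg f -> sqintg g ->
  `|E (fun x => f x * g x)| <=
    Num.sqrt (E (fun x => f x ^+ 2)) * Num.sqrt (E (fun x => g x ^+ 2)).
Proof.
move=> sf sg; have := expect_cauchy_schwarz sf sg.
have e0 (h : T -> R) : 0 <= E (fun x => h x ^+ 2).
  by apply: expect_ge0 => x; exact: sqr_ge0.
move=> cs; rewrite -ler_sqr ?nnegrE ?mulr_ge0 ?sqrtr_ge0//.
by rewrite real_normK ?num_real// exprMn !sqr_sqrtr.
Qed.

Lemma expect_mul_cvg (F G : nat -> T -> R) f g :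
  (forall n, sqintg (F n)) -> (forall n, sqintg (G n)) -> sqintg f -> sqintg g ->
  E (fun x => (F n x - f x) ^+ 2) @[n --> \oo] --> 0 ->
  E (fun x => (G n x - g x) ^+ 2) @[n --> \oo] --> 0 ->
  E (fun x => F n x * G n x) @[n --> \oo] --> E (fun x => f x * g x).
Proof.
move=> sF sG sf sg cF cG.
have sq0 (u : nat -> R) : u n @[n --> \oo] --> 0 -> Num.sqrt (u n) @[n --> \oo] --> 0.
  move=> u0; rewrite -[X in _ --> X]sqrtr0.
  by apply: (cvg_comp _ _ u0); exact: sqrt_continuous.
have {}cF := sq0 _ cF; have {}cG := sq0 _ cG.
pose a n := Num.sqrt (E (fun x => (F n x - f x) ^+ 2)).
pose b n := Num.sqrt (E (fun x => (G n x - g x) ^+ 2)).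
pose nf := Num.sqrt (E (fun x => f x ^+ 2)).
pose ng := Num.sqrt (E (fun x => g x ^+ 2)).
have bnd n : `|E (fun x => f x * g x) - E (fun x => F n x * G n x)| <=
    a n * b n + a n * ng + nf * b n.
  have sa := sqintgB (sF n) sf; have sb := sqintgB (sG n) sg.
  have i1 := sqintgM sa sb; have i2 := sqintgM sa sg; have i3 := sqintgM sf sb.
  rewrite distrC -expectB; [|exact: sqintgM..].
  rewrite (_ : (fun x => _) = (fun x => (F n x - f x) * (G n x - g x) +
    (F n x - f x) * g x + f x * (G n x - g x))); last by apply/funext => x; ring.
  rewrite (expectD (intgD i1 i2) i3) (expectD i1 i2).
  apply: (le_trans (ler_normD _ _)); apply: lerD; last exact: expect_mul_le.
  by apply: (le_trans (ler_normD _ _)); apply: lerD; exact: expect_mul_le.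
have b0 : a n * b n + a n * ng + nf * b n @[n --> \oo] --> (0 : R).
  rewrite (_ : 0 = 0 * 0 + 0 * ng + nf * 0); last by ring.
  apply: cvgD; first apply: cvgD; apply: cvgM => //; exact: cvg_cst.
apply/cvgrPdist_lt => e e0.
have /cvgr0_norm_lt/(_ e e0) := b0; apply: filterS => j bj.
by apply: le_lt_trans (bnd j) _; apply: le_lt_trans bj; exact: ler_norm.
Qed.

End L2_limits.

(** * Second moments of multiple integrals *)

Section chaos.
Context {R : realType} (W : abstract_wiener_space R).
Local Notation H := (aws_H W).
Local Notation B := (borel (aws_B W)).
Local Notation mu := (aws_mu W).
Local Notation ip := (aws_ip W).
Local Notation E := (expect mu).
Local Notation intg := (intg mu).
Local Notation sqintg := (sqintg mu).
Variables (tilde : H -> B -> R) (I : forall n, (('I_n -> H) -> R) -> B -> R).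
Hypotheses (Htilde : gaussian_extension tilde) (HI : multiple_integral tilde I).

Lemma mi_sqintg n (f : ('I_n -> H) -> R) : sym_tensor ip f -> sqintg (I f).
Proof. by move=> sf; apply/Lfun2P; exact: (mi_L2 HI). Qed.

Lemma mi_zero n : I (fun _ : 'I_n -> H => 0) = (fun=> 0) %[ae mu].
Proof.
have s0 := @sym_tensor0 _ _ ip n.
have := mi_linear HI 1 s0 s0.
rewrite (_ : (fun h => _) = fun _ : 'I_n -> H => 0); last first.
  by apply/funext => h; rewrite mulr0 addr0.
by apply: filterS => x /= h1 _; have := h1 Logic.I; rewrite mul1r => h2; lra.
Qed.

(** The Hermite formula is prescribed only for nonzero vectors, but polarization includes the empty
    set of indices, whose vector is 0. The value there follows the power of 0, which is 1 in order 0
    and 0 otherwise. *)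
Definition chaos_pow n (h : H) : B -> R :=
  if h == 0 then fun=> (n == 0%N)%:R
  else fun x => `|h| ^+ n * hermite n (tilde h x / `|h|).

Lemma mi_chaos_pow n h : I (tensor_pow ip h : ('I_n -> H) -> R) = chaos_pow n h %[ae mu].
Proof.
rewrite /chaos_pow; have [->|h0] := eqVneq h 0; last exact: (mi_pow HI).
case: n => [|n] /=.
  have := mi_const HI (tensor_pow ip 0).
  by rewrite /tensor_pow big_ord0.
rewrite (_ : tensor_pow ip 0 = fun _ : 'I_n.+1 -> H => 0); first exact: mi_zero.
by apply/funext => k; rewrite /tensor_pow big_ord_recl ipC ip0r mul0r.
Qed.

Lemma measurable_chaos_pow n h : measurable_fun setT (chaos_pow n h).
Proof.
rewrite /chaos_pow; case: ifP => _; first exact: measurable_cst.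
apply: measurable_funM => //.
rewrite (_ : (fun x => _) = fun x => \sum_(i < size (@hermite_poly R n))
    (hermite_poly n)`_i * (tilde h x / `|h|) ^+ i); last first.
  by apply/funext => x; rewrite hermiteE horner_coef.
apply: measurable_sum => i; apply: measurable_funM => //; apply: measurable_funX.
by apply: measurable_funM => //; exact: (tilde_sqintg Htilde h).1.
Qed.

Lemma expect_chaos_pow n m h k :
  E (fun x => chaos_pow n h x * chaos_pow m k x) =
  (n == m)%:R * (n`!%:R * ip h k ^+ n).
Proof.
(* If one vector is 0 its factor is constant, so only the mean of the other one matters; it is the
   covariance with H_0 = 1. *)
have one j (v : H) : v != 0 -> E (chaos_pow j v) = (j == 0%N)%:R.
  move=> v0; rewrite /chaos_pow (negbTE v0).
  have := expect_hermite Htilde 0 j v0 v0; rewrite eq_sym !mulr1 => <-.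
  by congr expect; apply/funext => x; rewrite (hermiteE 0) hornerC expr0 !mul1r.
have [->|h0] := eqVneq h 0.
  rewrite ipC ip0r expr0n.
  have -> : chaos_pow n 0 = fun=> (n == 0%N)%:R by rewrite /chaos_pow eqxx.
  have [->|k0] := eqVneq k 0.
    rewrite {1}/chaos_pow eqxx expect_cst.
    by case: n => [|n]; rewrite ?mul0r ?mulr0// mul1r fact0 !mulr1 eq_sym.
  case: n => [|n] /=.
    under eq_fun do rewrite mul1r.
    by rewrite one// fact0 !mulr1 eq_sym.
  by under eq_fun do rewrite mul0r; rewrite expect_cst !mulr0.
have [->|k0] := eqVneq k 0.
  rewrite ip0r expr0n.
  have -> : chaos_pow m 0 = fun=> (m == 0%N)%:R by rewrite /chaos_pow eqxx.
  case: m => [|m] /=.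
    under eq_fun do rewrite mulr1.
    by rewrite one//; case: n => [|n]; rewrite ?mul0r// fact0 !mulr1.
  under eq_fun do rewrite mulr0.
  by rewrite expect_cst; case: n => [|n]; rewrite /= ?mul0r ?mulr0.
by rewrite -(expect_hermite Htilde n m h0 k0) /chaos_pow (negbTE h0) (negbTE k0).
Qed.

Lemma mi_pow_comb n (s : seq (R * H)) :
  I (@pow_comb _ _ ip n s) = (fun x => \sum_(p <- s) p.1 * chaos_pow n p.2 x) %[ae mu].
Proof.
elim: s => [|p s ih].
  rewrite (_ : pow_comb ip [::] = fun=> 0); last first.
    by apply/funext => h; rewrite /pow_comb big_nil.
  by under [X in _ = X %[ae _]]eq_fun do rewrite big_nil; exact: mi_zero.
rewrite (_ : pow_comb ip (p :: s) = fun h => p.1 * tensor_pow ip p.2 h + pow_comb ip s h); last first.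
  by apply/funext => h; rewrite /pow_comb big_cons.
have := mi_linear HI p.1 (tensor_pow_sym ip n p.2) (pow_comb_sym ip n s).
move: (mi_chaos_pow n p.2) ih; apply: filterS3 => x h1 h2 h3 _.
by rewrite big_cons -(h1 Logic.I) -(h2 Logic.I) (h3 Logic.I).
Qed.

Lemma chaos_pow_sqintg n h : sqintg (chaos_pow n h).
Proof.
have mK := measurable_chaos_pow n h; split => //.
have [mI i2] := mi_sqintg (tensor_pow_sym ip n h).
apply/integrableP; split; first by apply/measurable_EFinP; exact: measurable_funX.
have /integrableP[_] := i2; congr (_ < _)%E; apply: ae_eq_integral => //.
- by apply: measurableT_comp => //; apply/measurable_EFinP; exact: measurable_funX.
- by apply: measurableT_comp => //; apply/measurable_EFinP; exact: measurable_funX.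
- by move: (mi_chaos_pow n h); apply: filterS => x h1 _ /=; rewrite (h1 Logic.I).
Qed.

Lemma expect_pow_comb n m (s t : seq (R * H)) :
  E (fun x => I (@pow_comb _ _ ip n s) x * I (@pow_comb _ _ ip m t) x) =
  (n == m)%:R * (n`!%:R * \sum_(p <- s) \sum_(q <- t) p.1 * q.1 * ip p.2 q.2 ^+ n).
Proof.
have ms j (u : seq (R * H)) : measurable_fun setT (fun x => \sum_(p <- u) p.1 * chaos_pow j p.2 x).
  apply: measurable_sum => p; apply: measurable_funM => //; exact: measurable_chaos_pow.
have mI j u := (mi_sqintg (pow_comb_sym ip j u)).1.
rewrite (@ae_eq_expect _ _ _ mu _ (fun x => \sum_(p <- s) \sum_(q <- t)
   (p.1 * q.1) * (chaos_pow n p.2 x * chaos_pow m q.2 x))).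
- rewrite expect_sum; last first.
    by move=> p _; apply: intg_sum => q _; apply: intgZ; apply: sqintgM; exact: chaos_pow_sqintg.
  rewrite !mulr_sumr; apply: eq_bigr => p _.
  rewrite expect_sum; last first.
    by move=> q _; apply: intgZ; apply: sqintgM; exact: chaos_pow_sqintg.
  rewrite !mulr_sumr; apply: eq_bigr => q _.
  rewrite expectZ; last by apply: sqintgM; exact: chaos_pow_sqintg.
  by rewrite expect_chaos_pow; ring.
- by apply: measurable_funM; exact: mI.
- apply: measurable_sum => p; apply: measurable_sum => q; apply: measurable_funM => //.
  by apply: measurable_funM; exact: measurable_chaos_pow.
- move: (mi_pow_comb n s) (mi_pow_comb m t); apply: filterS2 => x h1 h2 _.
  rewrite (h1 Logic.I) (h2 Logic.I) mulr_suml; apply: eq_bigr => p _.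
  by rewrite mulr_sumr; apply: eq_bigr => q _; rewrite mulrACA.
Qed.

(** Expanding the second moment over [s] twice gives a double sum of inner products to the power n.
    One sum reassembles the compression evaluated at (v, ..., v) for each vector v of [s]; expanding
    that value in [e], the other sum reassembles the compression at basis vectors, where it equals
    [f]. *)
Lemma expect_form_proj n (f : ('I_n -> H) -> R) d (e : 'I_d -> H) s :
  orthonormal_family ip e -> form_proj ip e f = pow_comb ip s ->
  E (fun x => I (form_proj ip e f) x ^+ 2) = n`!%:R * hs_sum e f.
Proof.
move=> on fs; under eq_fun do rewrite expr2.
rewrite fs expect_pow_comb eqxx mul1r; congr (_ * _).
transitivity (\sum_(p <- s) p.1 * pow_comb ip s (fun _ : 'I_n => p.2)).
  apply: eq_bigr => p _; rewrite /pow_comb mulr_sumr; apply: eq_bigr => q _.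
  by rewrite /tensor_pow prodr_const card_ord ipC mulrA.
rewrite -fs /form_proj.
under eq_bigr do rewrite mulr_sumr.
rewrite exchange_big; apply: eq_bigr => i _ /=.
rewrite expr2 -{3}(form_proj_base f i on) fs /pow_comb mulr_sumr.
apply: eq_bigr => p _; rewrite mulrCA; congr (_ * (_ * _)).
by apply: eq_bigr => k _; rewrite ipC.
Qed.

(** The approximants are compressions whose norm defect is below 1/(j+1). Their second moments are
    bounded with the exact factor n!, while the constant of [mi_continuous] only governs the speed
    of convergence. *)
Lemma mi_approx n (f : ('I_n -> H) -> R) : sym_tensor ip f ->
  exists s : nat -> seq (R * H),
  (forall j, E (fun x => I (pow_comb ip (s j) : ('I_n -> H) -> R) x ^+ 2) <=
     n`!%:R * fine (hs_norm2 ip f)) /\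
  E (fun x => (I (pow_comb ip (s j) : ('I_n -> H) -> R) x - I f x) ^+ 2) @[j --> \oo] --> 0.
Proof.
move=> sf; have [C hC] := mi_continuous HI n.
have ex (j : nat) : exists s : seq (R * H),
   E (fun x => I (pow_comb ip s : ('I_n -> H) -> R) x ^+ 2) <= n`!%:R * fine (hs_norm2 ip f) /\
   (* The absolute value is taken because [C] comes without a sign, and multiplication by it must be
      monotone. *)
   E (fun x => (I (pow_comb ip s : ('I_n -> H) -> R) x - I f x) ^+ 2) <= `|C| * j.+1%:R^-1.
  have e0 : 0 < j.+1%:R^-1 :> R by rewrite invr_gt0 ltr0n.
  have [d [e on lt]] := hs_sum_approx sf e0.
  have [_ syf _] := sf.
  have [s fs] := form_proj_pow_comb ip e syf.
  exists s; rewrite -fs; split.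
    rewrite (expect_form_proj on fs) ler_wpM2l//; exact: hs_sum_fine.
  have sp : sym_tensor ip (form_proj ip e f) by rewrite fs; exact: pow_comb_sym.
  have sd := sym_tensorZD (-1) sp sf.
  have sqd := mi_sqintg sd.
  have sqB := sqintgB (mi_sqintg sp) (mi_sqintg sf).
  rewrite (@ae_eq_expect _ _ _ mu _ (fun x =>
     I (fun h => -1 * form_proj ip e f h + f h) x ^+ 2)).
  - rewrite -lee_fin.
    have := hC _ sd; rewrite unlock -EFin_expect; last exact: sqd.2.
    move=> /le_trans; apply.
    apply: (@le_trans _ _ (`|C|%:E * hs_norm2 ip (fun h => -1 * form_proj ip e f h + f h)%R)%E).
      by apply: lee_wpmul2r; [exact: hs_norm2_ge0|rewrite lee_fin ler_norm].
    rewrite EFinM; apply: lee_wpmul2l; first by rewrite lee_fin.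
    by apply: (le_trans (hs_norm2_sub_proj sf on)); rewrite lee_fin lerBlDr addrC -lerBlDr ltW.
  - by apply: measurable_funX; exact: sqB.1.
  - by apply: measurable_funX; exact: sqd.1.
  - have := mi_linear HI (-1) sp sf; apply: filterS => x h1 _.
    by rewrite (h1 Logic.I); ring.
have [s hs] := choice ex; exists s; split; first by move=> j; have [] := hs j.
have c0 : `|C| * j.+1%:R^-1 @[j --> \oo] --> (0 : R).
  rewrite -[X in _ --> X](mulr0 `|C|); apply: cvgM; first exact: cvg_cst.
  exact: cvg_harmonic.
apply: (squeeze_cvgr _ (cvg_cst 0) c0); apply: nearW => j.
by rewrite (hs j).2 andbT; apply: expect_ge0 => x; exact: sqr_ge0.
Qed.

Lemma mi_norm_le n (f : ('I_n -> H) -> R) : sym_tensor ip f ->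
  E (fun x => I f x ^+ 2) <= n`!%:R * fine (hs_norm2 ip f).
Proof.
move=> sf; have [s [s1 s2]] := mi_approx sf.
have sI j := mi_sqintg (pow_comb_sym ip n (s j)).
have := expect_mul_cvg sI sI (mi_sqintg sf) (mi_sqintg sf) s2 s2.
move=> cv; rewrite (_ : (fun x => _) = fun x => I f x * I f x); last first.
  by apply/funext => x; rewrite expr2.
rewrite -(cvg_lim _ cv)//; apply: limr_le; first by apply/cvg_ex; eexists; exact: cv.
apply: nearW => j; have := s1 j; by [].
Qed.

Lemma mi_orthogonal n m (f : ('I_n -> H) -> R) (g : ('I_m -> H) -> R) :
  n != m -> sym_tensor ip f -> sym_tensor ip g ->
  E (fun x => I f x * I g x) = 0.
Proof.
move=> nm sf sg; have [s [_ s2]] := mi_approx sf; have [t [_ t2]] := mi_approx sg.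
have sI j := mi_sqintg (pow_comb_sym ip n (s j)).
have tI j := mi_sqintg (pow_comb_sym ip m (t j)).
have := expect_mul_cvg sI tI (mi_sqintg sf) (mi_sqintg sg) s2 t2.
have e0 j : E (fun x => I (pow_comb ip (s j) : ('I_n -> H) -> R) x *
   I (pow_comb ip (t j) : ('I_m -> H) -> R) x) = 0.
  by rewrite expect_pow_comb (negbTE nm) mul0r.
rewrite (funext e0) => cv.
by apply: (cvg_unique _ cv); [|exact: cvg_cst].
Qed.

End chaos.

(** * Convergence of the partial Wick products *)

Section completeness.
Context {d} {T : measurableType d} {R : realType} (P : probability T R).
Local Notation E := (expect P).
Local Notation intg := (intg P).
Local Notation sqintg := (sqintg P).

(** The L^1 norms of the increments are at most 2^(-n), so the sum of their absolute values is
    integrable, hence finite almost everywhere, and the telescoping series converges absolutely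
    there. *)
Lemma ae_cvg_of_summable (G : nat -> T -> R) :
  (forall n, sqintg (G n)) ->
  (forall n, E (fun x => (G n.+1 x - G n x) ^+ 2) <= ((2^-1) ^+ n) ^+ 2) ->
  {ae P, forall x, cvgn (fun n => G n x)}.
Proof.
move=> sG hG; pose D n x := G n.+1 x - G n x.
have sD n : sqintg (D n) by exact: sqintgB.
have iD n : intg (fun x => `|D n x|) by apply: intg_norm; exact: sqintg_intg.
have ED n : E (fun x => `|D n x|) <= (2^-1) ^+ n.
  apply: (le_trans (expect_norm_le (sD n))).
  have -> : (2^-1) ^+ n = Num.sqrt (((2^-1) ^+ n) ^+ 2) :> R.
    by rewrite sqrtr_sqr ger0_norm// exprn_ge0.
  by apply: ler_wsqrtr; exact: hG.
have mD n : measurable_fun setT (fun x => (`|D n x|)%:E).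
  by apply/measurable_EFinP; exact: intg_measurable (iD n).
have D0 n x : setT x -> (0 <= (`|D n x|)%:E)%E by move=> _; rewrite lee_fin.
have intS : P.-integrable setT (fun x => \sum_(0 <= n <oo) (`|D n x|)%:E)%E.
  apply/integrableP; split.
    by apply: ge0_emeasurable_sum => // k x _ _; rewrite lee_fin.
  rewrite (eq_integral (fun x => \sum_(0 <= n <oo) (`|D n x|)%:E)%E); last first.
    by move=> x _; rewrite gee0_abs//; apply: nneseries_ge0 => n _ _; rewrite lee_fin.
  rewrite integral_nneseries//; apply: (@le_lt_trans _ _ 2%:E); last exact: ltry.
  apply: lime_le.
    by apply: is_cvg_nneseries => n _ _; apply: integral_ge0 => x _; rewrite lee_fin.
  apply: nearW => n.
  rewrite (eq_bigr (fun n => (E (fun x => `|D n x|))%:E)); last first.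
    by move=> k _; rewrite -EFin_expect.
  rewrite sumEFin lee_fin.
  (* The exact partial geometric sum, since the bare bound 2 would not carry an induction. *)
  apply: (@le_trans _ _ (2 - 2 * (2^-1) ^+ n)); last first.
    by rewrite gerBl mulr_ge0// exprn_ge0.
  elim: n => [|n ih]; first by rewrite big_geq// expr0 mulr1 subrr.
  rewrite big_nat_recr//=; apply: (le_trans (lerD ih (ED n))).
  by rewrite exprS; lra.
have := integrable_ae measurableT intS; apply: filterS => x /(_ Logic.I) fx.
have lt : (\sum_(0 <= n <oo) (`|D n x|)%:E < +oo)%E by rewrite ltey_eq fx.
have c1 := nnseries_is_cvg (fun n => normr_ge0 (D n x)) lt.
have c2 : cvgn (series (fun n => D n x)) by apply: normed_cvg.
have -> : (fun n => G n x) = (fun n => G 0%N x + series (fun n => D n x) n).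
  by apply/funext => n; rewrite (eq_sum_telescope (fun n => G n x) n).
by apply: is_cvgD => //; exact: is_cvg_cst.
Qed.

(** The Riesz-Fischer argument: a fast subsequence converges almost everywhere, and Fatou along it
    bounds the distance from the limit to every [F M], so the whole sequence converges. *)
Lemma L2_complete (F : nat -> T -> R) (rho : nat -> R) :
  (forall n, sqintg (F n)) ->
  (forall M N, (M <= N)%N -> E (fun x => (F N x - F M x) ^+ 2) <= rho M) ->
  rho M @[M --> \oo] --> 0 ->
  exists2 f, sqintg f & L2_cvg P F f.
Proof.
move=> sF hF rho0.
have ex k : exists n, forall m, (n <= m)%N -> rho m <= ((2^-1) ^+ k) ^+ 2.
  have e0 : 0 < ((2^-1) ^+ k) ^+ 2 :> R by rewrite !exprn_gt0.
  have /cvgr0_norm_le/(_ _ e0) := rho0; case=> N _ hN; exists N => m Nm.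
  exact: le_trans (ler_norm _) (hN m Nm).
have [phi hphi] := choice ex.
(* Summing the thresholds makes the indices monotone and at least as large as both [phi k] and
   [k]. *)
pose psi k := (\sum_(i < k.+1) (phi i).+1)%N.
have psiS k : (psi k <= psi k.+1)%N by rewrite /psi [leqRHS]big_ord_recr leq_addr.
have phi_psi k : (phi k <= psi k)%N.
  by rewrite /psi big_ord_recr /= (leq_trans (leqnSn _))// leq_addl.
have psi_ge k : (k <= psi k)%N.
  elim: k => [//|k ih]; rewrite /psi big_ord_recr /= -/(psi k) addnS ltnS.
  by rewrite (leq_trans ih)// leq_addr.
have aec := @ae_cvg_of_summable (fun k => F (psi k)) (fun k => sF _)
  (fun k => le_trans (hF _ _ (psiS k)) (hphi k _ (phi_psi k))).
(* The upper limit is measurable everywhere; where the subsequence converges it is the limit, and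
   elsewhere [fine] sends infinite values to 0. *)
pose f x := fine (limn_esup (fun k => (F (psi k) x)%:E)).
have mf : measurable_fun setT f.
  apply: measurableT_comp; first exact: fine_measurable.
  apply: measurable_fun_limn_esup => k; apply/measurable_EFinP; exact: (sF _).1.
have fE : {ae P, forall x, F (psi k) x @[k --> \oo] --> f x}.
  move: aec; apply: filterS => x cx.
  have h : (F (psi k) x)%:E @[k --> \oo] --> (limn (fun k => F (psi k) x))%:E.
    by apply: cvg_EFin; [exact: nearW|exact: cx].
  by rewrite /f (cvg_limn_einf_sup h).2; exact: cx.
have key M : intg (fun x => (f x - F M x) ^+ 2) /\ E (fun x => (f x - F M x) ^+ 2) <= rho M.
  apply: (@fatou_intg _ _ _ P (fun k x => (F (psi k) x - F M x) ^+ 2)).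
  - by move=> k; exact: (sqintgB (sF _) (sF _)).2.
  - by move=> k x; exact: sqr_ge0.
  - apply: measurable_funX; apply: measurable_funB => //; exact: (sF _).1.
  - by move=> x; exact: sqr_ge0.
  - move: fE; apply: filterS => x fx; rewrite expr2.
    have h : F (psi k) x - F M x @[k --> \oo] --> f x - F M x.
      by apply: cvgB => //; exact: cvg_cst.
    by rewrite (funext (fun k => expr2 (F (psi k) x - F M x))); exact: cvgM.
  - exists M => // k Mk; apply: hF; exact: leq_trans Mk (psi_ge k).
have sf : sqintg f.
  have sd : sqintg (fun x => f x - F 0%N x).
    split; last exact: (key 0%N).1.
    by apply: measurable_funB => //; exact: (sF _).1.
  have := sqintgD sd (sF 0%N).
  by under eq_fun do rewrite subrK.
exists f => //; apply/(L2_cvgP sF sf).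
apply: (squeeze_cvgr _ (cvg_cst 0) rho0); apply: nearW => M.
apply/andP; split; first by apply: expect_ge0 => x; exact: sqr_ge0.
apply: le_trans (key M).2; rewrite le_eqVlt; apply/orP; left; apply/eqP.
by congr expect; apply/funext => x; rewrite -sqrrN opprB.
Qed.

(* AM-GM on terms of equal degree:
   [2 J_x J_y <= (w_y / w_x) J_x^2 + (w_x / w_y) J_y^2]. *)
Lemma weighted_sum_bound (K : finType) (A : pred K) (J : K -> T -> R) (deg : K -> nat)
    (w b : K -> R) :
  (forall x, sqintg (J x)) -> (forall x, 0 < w x) -> (forall x, 0 <= b x) ->
  (forall x, E (fun t => J x t ^+ 2) <= w x * b x) ->
  (forall x y, deg x != deg y -> E (fun t => J x t * J y t) = 0) ->
  (forall k, \sum_(x | A x && (deg x == k)) w x <= 1) ->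
  E (fun t => (\sum_(x | A x) J x t) ^+ 2) <= \sum_(x | A x) b x.
Proof.
move=> sJ w0 b0 Jw orth w1.
have e t : (\sum_(x | A x) J x t) ^+ 2 = \sum_(x | A x) \sum_(y | A y) J x t * J y t.
  by rewrite expr2 mulr_suml; apply: eq_bigr => x _; rewrite mulr_sumr.
under eq_fun do rewrite e.
have iJ x y : intg (fun t => J x t * J y t) by exact: sqintgM.
rewrite expect_sum; last by move=> x _; apply: intg_sum.
under eq_bigr => x _ do rewrite expect_sum//.
(* [w y * b x] bounds the share of J_x^2 in the pair: its coefficient is w_y / w_x and its
   expectation at most w_x b_x. Summing over [y] of the same degree then leaves at most [b x]. *)
pose c x y := (deg x == deg y)%:R * (w y * b x) : R.
have pairle x y : E (fun t => J x t * J y t) <= 2^-1 * (c x y + c y x).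
  rewrite /c [deg y == _]eq_sym; have [dxy|dxy] := eqVneq (deg x) (deg y); last first.
    by rewrite orth// !mul0r addr0 mulr0.
  rewrite !mul1r.
  have wx := w0 x; have wy := w0 y.
  have le1 t : J x t * J y t <= 2^-1 * (w y / w x * J x t ^+ 2 + w x / w y * J y t ^+ 2).
    rewrite -subr_ge0 (_ : _ - _ = 2^-1 * (w y * J x t - w x * J y t) ^+ 2 / (w x * w y)).
      by apply: divr_ge0; [rewrite mulr_ge0 ?sqr_ge0|rewrite mulr_ge0 ?ltW].
    by field; rewrite !gt_eqF.
  have ix := intgZ (w y / w x) (sJ x).2; have iy := intgZ (w x / w y) (sJ y).2.
  apply: (le_trans (expect_le (iJ x y) (intgZ 2^-1 (intgD ix iy)) le1)).
  rewrite (expectZ _ (intgD ix iy)) (expectD ix iy) (expectZ _ (sJ x).2) (expectZ _ (sJ y).2).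
  apply: ler_wpM2l => //; apply: lerD.
    apply: (le_trans (ler_wpM2l _ (Jw x))); first by rewrite divr_ge0 ?ltW.
    by rewrite mulrA divfK ?gt_eqF.
  apply: (le_trans (ler_wpM2l _ (Jw y))); first by rewrite divr_ge0 ?ltW.
  by rewrite mulrA divfK ?gt_eqF.
apply: (@le_trans _ _ (\sum_(x | A x) \sum_(y | A y) 2^-1 * (c x y + c y x))).
  by apply: ler_sum => x _; apply: ler_sum => y _.
have -> : \sum_(x | A x) \sum_(y | A y) 2^-1 * (c x y + c y x) =
    \sum_(x | A x) \sum_(y | A y) c x y.
  under eq_bigr do rewrite -mulr_sumr big_split.
  rewrite -mulr_sumr big_split /= [X in _ + X]exchange_big /=.
  by move: (\sum_(_ | _) _) => z; field.
apply: ler_sum => x _; rewrite /c.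
apply: (@le_trans _ _ ((\sum_(y | A y && (deg y == deg x)) w y) * b x)); last first.
  by rewrite ler_piMl.
rewrite mulr_suml big_mkcondr; rewrite le_eqVlt; apply/orP; left; apply/eqP.
apply: eq_bigr => y _; rewrite eq_sym; case: ifP => _; rewrite ?mul1r ?mul0r//.
Qed.

End completeness.

(** * Binomial weights and differences of square partial sums *)

Lemma binomial_weight_le {R : realType} (N k : nat) (A : pred ('I_N * 'I_N)) (u v : R) :
  0 <= u -> 0 <= v -> u + v = 1 ->
  \sum_(x : 'I_N * 'I_N | A x && (x.1 + x.2 == k)%N)
     'C(x.1 + x.2, x.1)%:R * u ^+ x.1 * v ^+ x.2 <= 1.
Proof.
move=> u0 v0 uv.
pose h n := 'C(k, n)%:R * u ^+ n * v ^+ (k - n).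
have h0 n : 0 <= h n by rewrite !mulr_ge0 ?exprn_ge0.
apply: (@le_trans _ _ (\sum_(x : 'I_N * 'I_N) (x.1 + x.2 == k)%N%:R * h x.1)).
  rewrite big_mkcond; apply: ler_sum => x _.
  case: ifP => [/andP[_ /eqP xk]|_].
    by rewrite /h -xk eqxx addKn mul1r.
  by rewrite mulr_ge0.
rewrite -(pair_bigA _ (fun i j : 'I_N => (i + j == k)%N%:R * h i)) /=.
apply: (@le_trans _ _ (\sum_(i < N) (i < k.+1)%N%:R * h i)).
  apply: ler_sum => i _; rewrite -mulr_suml ler_wpM2r//.
  have [ik|ik] := ltnP i k.+1; last first.
    rewrite big1// => j _; rewrite (_ : (_ == _) = false)//; apply/eqP; lia.
  have [kN|kN] := ltnP (k - i) N.
    rewrite (bigD1 (Ordinal kN))//= big1 ?addr0; first by case: (_ == _); rewrite ?lexx.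
    move=> j jk; rewrite (_ : (_ == _) = false)//; apply/eqP => ijk.
    by move/eqP: jk; apply; apply/val_inj => /=; lia.
  rewrite big1// => j _; rewrite (_ : (_ == _) = false)//; apply/eqP.
  by have := ltn_ord j; lia.
rewrite [leRHS](_ : 1 = \sum_(i < k.+1) h i); last first.
  rewrite -(expr1n _ k) -uv addrC exprDn; apply: eq_bigr => i _.
  by rewrite /h -mulr_natl; ring.
(* A common index range for the sums over [i < N] and [i < k.+1], neither bound being known to be
   the smaller. *)
pose L := (N + k.+1)%N.
have e1 : \sum_(i < N) (i < k.+1)%N%:R * h i = \sum_(i < L | (i < N)%N) (i < k.+1)%N%:R * h i.
  by rewrite (big_ord_widen L (fun i : nat => (i < k.+1)%N%:R * h i)) ?leq_addr.
have e2 : \sum_(i < k.+1) h i = \sum_(i < L | (i < k.+1)%N) h i.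
  by rewrite (big_ord_widen L h) ?leq_addl.
rewrite e1 e2.
rewrite big_mkcond [leRHS]big_mkcond; apply: ler_sum => i _.
by case: (i < k.+1)%N; case: (i < N)%N; rewrite ?mul1r ?mul0r.
Qed.

(** The index set is the L-shaped region between two squares. It serves twice, for the partial Wick
    products and for the products of partial norms that bound them. *)
Lemma double_sum_diff {R : zmodType} (F : nat -> nat -> R) (M N : nat) : (M <= N)%N ->
  \sum_(x : 'I_N * 'I_N | ~~ ((x.1 < M)%N && (x.2 < M)%N)) F x.1 x.2 =
  \sum_(n < N) \sum_(m < N) F n m - \sum_(n < M) \sum_(m < M) F n m.
Proof.
move=> MN; rewrite (pair_bigA _ (fun i j : 'I_N => F i j)) /=.
rewrite [X in _ = X - _](bigID (fun x : 'I_N * 'I_N => (x.1 < M)%N && (x.2 < M)%N)) /=.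
rewrite (big_ord_widen N (fun n => \sum_(m < M) F n m))//.
under [X in _ = _ - X]eq_bigr do rewrite (big_ord_widen N (F _))//.
by rewrite (pair_big _ _ (fun i j : 'I_N => F i j)) /= addrAC subrr add0r.
Qed.

Section wick_product.
Context {R : realType} (W : abstract_wiener_space R).
Local Notation H := (aws_H W).
Local Notation B := (borel (aws_B W)).
Local Notation mu := (aws_mu W).
Local Notation ip := (aws_ip W).
Local Notation E := (expect mu).
Variables (tilde : H -> B -> R) (I : forall n, (('I_n -> H) -> R) -> B -> R).
Hypotheses (Htilde : gaussian_extension tilde) (HI : multiple_integral tilde I).

(** The n-th term of the series for the squared norm of Gamma(alpha)F, as a real number; [fine]
    loses nothing on symmetric tensors, whose norm is finite. *)
Definition quantized (alpha : R) (f : forall n, ('I_n -> H) -> R) (n : nat) : R :=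
  n`!%:R * alpha ^+ (2 * n) * fine (hs_norm2 ip (f n)).

Lemma quantized_ge0 alpha f n : 0 <= quantized alpha f n.
Proof.
apply: mulr_ge0; last by rewrite fine_ge0// hs_norm2_ge0.
by rewrite exprM mulr_ge0// exprn_ge0// sqr_ge0.
Qed.

Lemma quantized_cvg alpha (f : forall n, ('I_n -> H) -> R) :
  (forall n, sym_tensor ip (f n)) ->
  (\sum_(0 <= n <oo) (n`!%:R * alpha ^+ (2 * n))%:E * hs_norm2 ip (f n) < +oo)%E ->
  exists2 l, \sum_(n < N.+1) quantized alpha f n @[N --> \oo] --> l &
    forall N, \sum_(n < N.+1) quantized alpha f n <= l.
Proof.
move=> sf lt.
have lt' : (\sum_(0 <= n <oo) (quantized alpha f n)%:E < +oo)%E.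
  move: lt; congr (_ < _)%E; apply: eq_eseriesr => n _.
  by rewrite hs_norm2_fin// -EFinM.
have cv := nnseries_is_cvg (quantized_ge0 alpha f) lt'.
have E1 N : \sum_(n < N.+1) quantized alpha f n = series (quantized alpha f) N.+1.
  by rewrite /series /= big_mkord.
exists (limn (series (quantized alpha f))).
  by rewrite (funext E1) (cvg_shiftS (series (quantized alpha f))); exact: cv.
move=> N; rewrite E1; apply: nondecreasing_cvgn_le => //.
by apply: nondecreasing_series => n _ _; exact: quantized_ge0.
Qed.

Lemma wick_finite_sqintg f g N M : (forall n, sym_tensor ip (f n)) ->
  (forall n, sym_tensor ip (g n)) -> sqintg mu (wick_finite I f g N M).
Proof.
move=> sf sg; apply: sqintg_sum => n _; apply: sqintg_sum => m _.
by apply: (mi_sqintg HI); exact: sym_prod_sym_tensor.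
Qed.

(** Since (n+m)! is C(n+m, n) n! m!, the bound on the integral of [sym_prod (f n) (g m)] is exactly
    the weight [w n m] times the product [b n m] of two terms of the quantized series. The weighted
    bound then removes [w], and the sum of [b] over the L-shaped region is a difference of
    products. *)
Lemma wick_finite_diff_le (p q : R) (f g : forall n, ('I_n -> H) -> R) (M N : nat) :
  0 < p -> 0 < q -> 1 / p ^+ 2 + 1 / q ^+ 2 = 1 ->
  (forall n, sym_tensor ip (f n)) -> (forall n, sym_tensor ip (g n)) ->
  (M <= N)%N ->
  E (fun x => (wick_finite I f g N N x - wick_finite I f g M M x) ^+ 2) <=
  (\sum_(n < N.+1) quantized p f n) * (\sum_(n < N.+1) quantized q g n) -
  (\sum_(n < M.+1) quantized p f n) * (\sum_(n < M.+1) quantized q g n).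
Proof.
move=> p0 q0 pq sf sg MN.
pose F n m := I (sym_prod (f n) (g m)).
pose A (x : 'I_N.+1 * 'I_N.+1) := ~~ ((x.1 < M.+1)%N && (x.2 < M.+1)%N).
pose b n m := quantized p f n * quantized q g m.
pose w n m : R := 'C(n + m, n)%:R * (1 / p ^+ 2) ^+ n * (1 / q ^+ 2) ^+ m.
have -> : (fun x => (wick_finite I f g N N x - wick_finite I f g M M x) ^+ 2) =
    (fun t => (\sum_(x | A x) F x.1 x.2 t) ^+ 2).
  by apply/funext => t; rewrite (double_sum_diff (fun n m => F n m t)).
have sumb L : (\sum_(n < L) quantized p f n) * (\sum_(n < L) quantized q g n) =
    \sum_(n < L) \sum_(m < L) b n m.
  by rewrite mulr_suml; apply: eq_bigr => n _; rewrite mulr_sumr.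
rewrite !sumb -(double_sum_diff b)//.
have sS n m := sym_prod_sym_tensor (sf n) (sg m).
apply: (@weighted_sum_bound _ _ _ mu _ A (fun x => F x.1 x.2)
  (fun x => x.1 + x.2)%N (fun x => w x.1 x.2) (fun x => b x.1 x.2)).
- by move=> x; exact: (mi_sqintg HI).
- move=> x; rewrite /w !mulr_gt0 ?exprn_gt0 ?divr_gt0 ?exprn_gt0//.
  by rewrite ltr0n bin_gt0 leq_addr.
- by move=> x; rewrite mulr_ge0 ?quantized_ge0.
- move=> [[n ln] [m lm]] /=; apply: (le_trans (mi_norm_le Htilde HI (sS n m))).
  have hs : fine (hs_norm2 ip (sym_prod (f n) (g m))) <=
      fine (hs_norm2 ip (f n)) * fine (hs_norm2 ip (g m)).
    by rewrite -lee_fin -hs_norm2_fin//; exact: sym_prod_hs.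
  apply: (le_trans (ler_wpM2l _ hs)) => //.
  rewrite le_eqVlt; apply/orP; left; apply/eqP.
  have := bin_fact (leq_addr m n); rewrite addKn => <-.
  rewrite /w /b /quantized !exprM !natrM !expr_div_n !expr1n.
  by field; rewrite !expf_neq0// gt_eqF.
- by move=> x y xy; exact: (mi_orthogonal Htilde HI).
- move=> k; rewrite /w; apply: binomial_weight_le => //.
    by rewrite divr_ge0 ?sqr_ge0.
  by rewrite divr_ge0 ?sqr_ge0.
Qed.

End wick_product.

Theorem theorem4p4 (R : realType) (W : abstract_wiener_space R)
    (tilde : aws_H W -> borel (aws_B W) -> R)
    (I : forall n, (('I_n -> aws_H W) -> R) -> borel (aws_B W) -> R)
    (Htilde : gaussian_extension tilde)
    (HI : multiple_integral tilde I)
    (F G : borel (aws_B W) -> R)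
    (HF : F \in Lfun (aws_mu W) 2%:E) (HG : G \in Lfun (aws_mu W) 2%:E)
    (p q : R) (Hp : 0 < p) (Hq : 0 < q)
    (Hpq : 1 / p ^+ 2 + 1 / q ^+ 2 = 1)
    (HGF : second_quantization_in_L2 I p F)
    (HGG : second_quantization_in_L2 I q G) :
  wick_product_exists I F G.
Proof.
have [f cF sumF] := HGF; have [g cG sumG] := HGG.
have [sf _] := cF; have [sg _] := cG.
have [lu cu leu] := quantized_cvg sf sumF.
have [lv cv lev] := quantized_cvg sg sumG.
pose U N := \sum_(n < N.+1) quantized p f n.
pose V N := \sum_(n < N.+1) quantized q g n.
have V0 N : 0 <= V N by apply: sumr_ge0 => n _; exact: quantized_ge0.
have U0 N : 0 <= U N by apply: sumr_ge0 => n _; exact: quantized_ge0.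
have [X sX cX] : exists2 X, sqintg (aws_mu W) X &
    L2_cvg (aws_mu W) (fun N => wick_finite I f g N N) X.
  (* The products [U N * V N] stay below [lu * lv], so the difference of products is bounded
     uniformly in [N] by this remainder, which tends to 0. *)
  apply: (@L2_complete _ _ _ (aws_mu W) _ (fun M => lu * lv - U M * V M)).
  - by move=> N; exact: (wick_finite_sqintg HI).
  - move=> M N MN.
    apply: (le_trans (wick_finite_diff_le Htilde HI Hp Hq Hpq sf sg MN)).
    by apply: lerB => //; apply: ler_pM; [exact: U0|exact: V0|exact: leu|exact: lev].
  - rewrite -[X in _ --> X](subrr (lu * lv)); apply: cvgB; first exact: cvg_cst.
    exact: cvgM.
exists X; first exact/Lfun2P.
by exists f, g.
Qed.
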